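(* If $\rho_n=\rho\in(0,1)$ is a fixed constant, then the overlap of two shortest path trees $T^{(1)},T^{(2)}$ sampled independently and uniformly at random from the shortest path trees (from vertex $1$) of $\overline G^{(1)}_n$ and $\overline G^{(2)}_n$ respectively tends to $0$: for every $\varepsilon>0$, \[\Pr\big(\mathsf R(T^{(1)},T^{(2)})>\varepsilon\big)\to0\quad (n\to\infty).\]
   Context: Let $(\alpha_n)$ be a sequence in $(0,\infty)$ with $0<\liminf\alpha_n\le\limsup\alpha_n<\infty$ and $q_n=\alpha_n\log n/n$. Let $G^{(1)}_n\sim\mathcal G(n,q_n)$ on $\{1,\dots,n\}$ and obtain $G^{(2)}_n$ by independently, for each unordered vertex pair, with probability $1-\rho_n$ resampling its adjacency as a fresh Bernoulli$(q_n)$. $\overline G^{(i)}_n$ is the connected component of $G^{(i)}_n$ containing vertex $1$. A shortest path tree of a connected graph from vertex $1$ is a spanning tree $T$ with $\mathsf d_T(1,v)=\mathsf d_G(1,v)$ for all $v$; its edges are directed away from $1$. For trees $T,T'$, $\mathsf R(T,T')=|T\cap T'|/\sqrt{|T||T'|}$, where $|T|$ is the number of edges and $T\cap T'$ is the set of common directed edges (same parent–child orientation). *)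

(* Defs.v *)
From HB Require Import structures.
From mathcomp Require Import all_boot all_order all_algebra.
From mathcomp Require Import all_classical all_reals all_analysis.

Set Implicit Arguments.
Unset Strict Implicit.
Unset Printing Implicit Defensive.

Import Order.TTheory GRing.Theory Num.Theory.
Import numFieldNormedType.Exports.
Local Open Scope ring_scope.

(* A finite simple graph with vertices in V is given by its vertex set
   C : {set V} and its edge set E : {set {set V}}, whose members are
   2-element subsets of C. *)

Definition adj (V : finType) (E : {set {set V}}) : rel V :=
  fun x y => (x != y) && ([set x; y]%SET \in E).

Definition has_walk (V : finType) (E : {set {set V}}) (x y : V) (k : nat) : bool :=
  [exists p : k.-tuple V, path (adj E) x p && (last x p == y)].

(* A walk of minimal length visits no vertex twice, so it has fewer than #|V|
   edges; the value #|V| is taken exactly when x and y are not connected. *)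
Definition gdist (V : finType) (E : {set {set V}}) (x y : V) : nat :=
  \big[minn/#|V|]_(k < #|V| | has_walk E x y k) (k : nat).

Definition comp_vertices (V : finType) (E : {set {set V}}) (r : V) : {set V} :=
  [set v | connect (adj E) r v]%SET.

Definition comp_edges (V : finType) (E : {set {set V}}) (r : V) : {set {set V}} :=
  [set e in E | e \subset comp_vertices E r]%SET.

Definition connected_on (V : finType) (C : {set V}) (T : {set {set V}}) : Prop :=
  {in C &, forall x y, connect (adj T) x y}.

Definition acyclic (V : finType) (T : {set {set V}}) : Prop :=
  forall s : seq V, (2 < size s)%N -> ~ ucycle (adj T) s.

Definition spanning_tree (V : finType) (C : {set V}) (E T : {set {set V}}) : Prop :=
  [/\ T \subset E, connected_on C T & acyclic T].

Definition shortest_path_tree (V : finType) (C : {set V}) (E : {set {set V}})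
    (r : V) (T : {set {set V}}) : Prop :=
  spanning_tree C E T /\ {in C, forall v, gdist T r v = gdist E r v}.

Definition comp_spts (V : finType) (E : {set {set V}}) (r : V) :
    {set {set {set V}}} :=
  [set T : {set {set V}} |
    `[< shortest_path_tree (comp_vertices E r) (comp_edges E r) r T >]]%SET.

(* (u, v) with u the parent of v. *)
Definition directed_edges (V : finType) (r : V) (T : {set {set V}}) : {set V * V} :=
  [set uv : V * V | adj T uv.1 uv.2 &&
    (gdist T r uv.2 == (gdist T r uv.1).+1)]%SET.

(* Equal to 0 when one of the trees has no edge, since x / 0 = 0. *)
Definition overlap (R : realType) (V : finType) (r : V) (T T' : {set {set V}}) : R :=
  #|directed_edges r T :&: directed_edges r T'|%:R
    / Num.sqrt (#|T|%:R * #|T'|%:R).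

Definition vpair (V : finType) : finType := {e : {set V} | #|e| == 2}.

(* For each pair: its status in the first graph, whether it is resampled, and
   the fresh status used in the second graph if it is. *)
Definition sample (V : finType) : finType := {ffun vpair V -> bool * bool * bool}.

Definition graph1 (V : finType) (w : sample V) : {set {set V}} :=
  [set val e | e in [set e : vpair V | (w e).1.1]]%SET.

Definition graph2 (V : finType) (w : sample V) : {set {set V}} :=
  [set val e | e in
    [set e : vpair V | if (w e).1.2 then (w e).2 else (w e).1.1]]%SET.

Definition sample_pmf (R : realType) (V : finType) (q rho : R) (w : sample V) : R :=
  \prod_(e : vpair V) (bernoulli_pmf q (w e).1.1
    * bernoulli_pmf (1 - rho) (w e).1.2 * bernoulli_pmf q (w e).2).

Definition unif_pmf (R : realType) (A : finType) (S : {set A}) (a : A) : R :=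
  (a \in S)%:R / #|S|%:R.

Definition joint_pmf (R : realType) (V : finType) (r : V) (q rho : R)
    (w : sample V) (T1 T2 : {set {set V}}) : R :=
  sample_pmf q rho w * unif_pmf R (comp_spts (graph1 w) r) T1
    * unif_pmf R (comp_spts (graph2 w) r) T2.

Definition Pr_overlap_gt (R : realType) (V : finType) (r : V) (q rho eps : R) : R :=
  \sum_(w : sample V) \sum_(T1 : {set {set V}}) \sum_(T2 : {set {set V}}
    | eps < overlap R r T1 T2) joint_pmf r q rho w T1 T2.

(* This exceeds 1 for at most finitely many n when alpha is bounded. *)
Definition edge_prob (R : realType) (alpha : nat -> R) (n : nat) : R :=
  alpha n * ln n%:R / n%:R.

(* Main.v *)
Require Import Defs.
From HB Require Import structures.
From mathcomp Require Import all_boot all_order all_algebra.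
From mathcomp Require Import all_classical all_reals all_analysis.
From mathcomp Require Import fintype finset.
From mathcomp Require Import ring lra zify.

Set Implicit Arguments.
Unset Strict Implicit.
Unset Printing Implicit Defensive.

Import Order.TTheory GRing.Theory Num.Theory.
Import numFieldNormedType.Exports.

(* Write n for the number of vertices and D = n q for the mean degree, which is
   of order log n.  Given the graph, a uniform shortest path tree picks the
   parent of every vertex v independently and uniformly among the N(v)
   neighbours of v in the previous layer; so v has the same parent in both trees
   with probability at most 1/max(N1(v), N2(v)), and it is enough that this is
   small for most v.

   Let l be the last level with D^l <= n / D^(3/4).  By a second moment argument
   layer l has size about D^l, hence the ball of radius l + 1 has more than A/D n
   vertices for every constant A.  By a union bound over all pairs of vertex
   sets, all but few vertices then either have at least M parents, or have all
   their parents in the ball of radius l (and the component of the root is almost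
   everything).  The vertices of the second kind, for both graphs, are counted by
   their common parents, which lie in the intersection I of the two balls of
   radius l.  A vertex enters I at level j + 1 either through an edge common to
   both graphs from level j, which costs a factor rho' D < D, or through two
   different edges, whence E|I| <= 2 (rho' D)^l + 16 D^(2l) / n, and D E|I| = o(n)
   since l tends to infinity faster than log D.

   Independence is obtained throughout by deleting vertices: whether the
   neighbours of v reach the root within j steps without v does not depend on the
   edges at v. *)

(** * Breadth-first layers *)

Section Balls.
Variables (V : finType) (r : V).
Implicit Types (e : rel V) (U W : {set V}) (v x : V) (j : nat).

(** The vertices within distance [j] of [r] in the graph with [U] deleted; empty if [r] is in [U].
    Carrying [U] makes the ball a function of the edges outside [U] only, which is the source of
    independence in all later estimates. *)
Fixpoint ball e U j : {set V} :=
  if j is i.+1 then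
    ball e U i :|: [set v in ~: U | [exists x in ball e U i, e x v]]%SET
  else [set r]%SET :\: U.

Definition layer e U j : {set V} :=
  if j is i.+1 then ball e U i.+1 :\: ball e U i else ball e U 0.

Lemma ballC e U j : ball e U j \subset ~: U.
Proof.
elim: j => [|j IH] /=; first by rewrite setDE subsetIr.
rewrite subUset IH; apply/subsetP => v.
by rewrite inE => /andP[].
Qed.

Lemma ball_notin e U j v : v \in ball e U j -> v \notin U.
Proof. by move/(subsetP (ballC e U j)); rewrite inE. Qed.

Lemma ballS e U j : ball e U j \subset ball e U j.+1.
Proof. exact: subsetUl. Qed.

Lemma ball_le e U i j : (i <= j)%N -> ball e U i \subset ball e U j.
Proof.
move=> /subnKC <-; elim: (j - i)%N => [|k IH]; first by rewrite addn0.
by rewrite addnS; apply: (subset_trans IH); exact: ballS.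
Qed.

Lemma in_ballS e U j v : (v \in ball e U j.+1) =
  (v \in ball e U j) || ((v \notin U) && [exists x in ball e U j, e x v]).
Proof. by rewrite /= !inE. Qed.

Lemma layer_sub e U j : layer e U j \subset ball e U j.
Proof. by case: j => [|j] //=; rewrite subDset subsetUr. Qed.

Lemma layer_ball e U j v : v \in layer e U j -> v \in ball e U j.
Proof. exact: (subsetP (layer_sub e U j)). Qed.

Lemma ball_layerU e U j : ball e U j.+1 = ball e U j :|: layer e U j.+1.
Proof.
apply/setP => v; rewrite /layer in_setU in_setD.
case: (boolP (v \in ball e U j)) => //= vj.
by rewrite (subsetP (ballS e U j)).
Qed.

Lemma ball_layer e U j v : v \in ball e U j ->
  exists2 i, (i <= j)%N & v \in layer e U i.
Proof.
elim: j => [|j IH]; first by move=> v0; exists 0%N.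
rewrite ball_layerU inE => /orP[/IH[i ij vi]|vj]; last by exists j.+1.
by exists i => //; exact: leqW.
Qed.

(** The walks that build a ball stay inside it, so vertices outside it can be deleted without
    changing it. *)
Lemma ball_remove e U W j : [disjoint W & ball e U j] ->
  ball e (W :|: U) j = ball e U j.
Proof.
elim: j => [|j IH] dW.
  apply/setP => v; rewrite /= !inE.
  case: (boolP (v \in W)) => //= vW.
  by have := disjointFr dW vW; rewrite /= !inE.
have dWj : [disjoint W & ball e U j].
  exact: (disjointWr (ballS e U j) dW).
apply/setP => v; rewrite !in_ballS (IH dWj) in_setU.
case: (boolP (v \in W)) => //= vW.
by have := disjointFr dW vW; rewrite in_ballS => ->; rewrite orbF;
  rewrite (disjointFr dWj vW).
Qed.

Lemma layer_remove e U W j : [disjoint W & ball e U j] ->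
  layer e (W :|: U) j = layer e U j.
Proof.
case: j => [|j] dW; rewrite /layer ?ball_remove //.
exact: (disjointWr (ballS e U j) dW).
Qed.

Lemma ball_remove_sub e U W j : ball e (W :|: U) j \subset ball e U j.
Proof.
elim: j => [|j IH]; first by apply: setDS; exact: subsetUr.
apply/subsetP => v; rewrite !in_ballS in_setU negb_or.
case/orP => [/(subsetP IH) -> //|/andP[/andP[_ ->]]].
case/existsP => x /andP[xb exv]; apply/orP; right.
by apply/existsP; exists x; rewrite exv (subsetP IH).
Qed.

Lemma layer_pred e U j v : v \in layer e U j.+1 ->
  exists2 x, x \in layer e U j & e x v.
Proof.
rewrite /layer inE in_ballS => /andP[vj]; rewrite (negPf vj) /=.
case/andP => vU /existsP[x /andP[xj exv]]; exists x => //.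
case: j => [|j] // in vj xj *; rewrite inE xj andbT.
apply: contra vj => xj'; rewrite in_ballS vU; apply/orP; right.
by apply/existsP; exists x; rewrite xj'.
Qed.

Lemma layerS_notin e U j v : v \in layer e U j.+1 -> v \notin ball e U j.
Proof. by rewrite inE => /andP[]. Qed.

(** If [v] enters at level [i + 1], its predecessor lies in layer [i], and the ball of radius [i]
    does not contain [v], hence survives its deletion. In this form the condition on [x] does not
    involve the edges at [v]. *)
Lemma ball_pred e U j v : v \in ball e U j.+1 -> v != r ->
  exists2 x, x \in ball e (v |: U) j & e x v.
Proof.
move=> /ball_layer[[|i]].
  by rewrite /= !inE => _ /andP[_ /eqP ->]; rewrite eqxx.
rewrite ltnS => ij vi _; have [x xi exv] := layer_pred vi.
exists x => //; apply: (subsetP (ball_le e (v |: U) ij)).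
by rewrite ball_remove ?layer_ball // disjoints1 layerS_notin.
Qed.

(** If [v] were already in the ball of radius [j], it would have a neighbour within distance [j - 1]
    of the root without [v]; uniqueness makes that neighbour [x], which lies in layer [j]. *)
Lemma layer_intro e U j v x : v \notin U -> v != r ->
  x \in layer e (v |: U) j -> e x v ->
  (forall y, y \in ball e (v |: U) j -> e y v -> y = x) ->
  v \in layer e U j.+1.
Proof.
move=> vU vr xj exv uniq_x; rewrite inE in_ballS vU /=.
have -> /= : [exists x0 in ball e U j, e x0 v].
  apply/existsP; exists x; rewrite exv andbT.
  exact: (subsetP (ball_remove_sub e U [set v]%SET j)) (layer_ball xj).
rewrite orbT andbT; case: j => [|j] in xj uniq_x *.
  by rewrite /= !inE (negPf vr) andbF.
apply/negP => /ball_pred /(_ vr)[y yj eyv].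
have yx := uniq_x y (subsetP (ballS _ _ _) y yj) eyv.
by move: xj; rewrite inE -yx yj.
Qed.

Lemma ball_ext e e' U j :
  (forall x y, x \notin U -> y \notin U -> e x y = e' x y) ->
  ball e U j = ball e' U j.
Proof.
move=> ee'; elim: j => [//|j IH]; apply/setP => v.
rewrite !in_ballS IH; case: (boolP (v \in U)) => //= vU.
congr (_ || _); apply: eq_existsb => x.
by case: (boolP (x \in ball e' U j)) => //= /ball_notin xU; rewrite ee'.
Qed.

Lemma layer_ext e e' U j :
  (forall x y, x \notin U -> y \notin U -> e x y = e' x y) ->
  layer e U j = layer e' U j.
Proof. by move=> ee'; case: j => [|j]; rewrite /layer !(ball_ext _ ee'). Qed.

End Balls.

Lemma natr_card (R : realType) (V : finType) (A : {set V}) :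
  (#|A|%:R = \sum_x (x \in A)%:R :> R)%R.
Proof. by rewrite -sum1_card natr_sum big_mkcond /=; apply: eq_bigr => x _; case: ifP. Qed.

(** * Distances and shortest path trees *)

Section Distances.
Variables (V : finType) (r : V).
Implicit Types (E : {set {set V}}) (u v x y : V) (j : nat).
Local Notation Ball E j := (ball r (adj E) set0 j).
Local Notation Layer E j := (layer r (adj E) set0 j).

Lemma adj_sym E : symmetric (adj E).
Proof. by move=> x y; rewrite /adj eq_sym setUC. Qed.

Lemma ball_pathP E j v :
  reflect (exists p, [/\ path (adj E) r p, last r p = v & (size p <= j)%N])
          (v \in Ball E j).
Proof.
apply: (iffP idP) => [|[p [+ <- +]]].
  elim: j v => [|j IH] v.
    by rewrite /= !inE /= => /eqP ->; exists [::].
  rewrite in_ballS inE /= => /orP[/IH[p [pp lp sp]]|].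
    by exists p; split => //; exact: leqW.
  case/existsP => x /andP[/IH[p [pp lp sp]] exv]; exists (rcons p v).
  by rewrite rcons_path pp lp exv last_rcons size_rcons.
elim: j p => [|j IH] p; first by case: p => // _ _; rewrite /= !inE /=.
elim/last_ind: p => [_ _|p x _].
  by apply: (subsetP (ball_le r _ _ (leq0n j.+1))); rewrite /= !inE /=.
rewrite rcons_path last_rcons size_rcons => /andP[pp ex] sp.
rewrite in_ballS inE /=; apply/orP; right; apply/existsP; exists (last r p).
by rewrite ex andbT; exact: IH.
Qed.

(** A walk shortens to one without repeated vertices, which has at most [#|V|.-1] edges, so the
    balls are constant from that radius on. *)
Lemma ball_card E j : Ball E j \subset Ball E #|V|.-1.
Proof.
apply/subsetP => v /ball_pathP[p [pp lp _]]; case/shortenP: pp lp => p' pp' up' _ lp'.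
apply/ball_pathP; exists p'; split => //.
have := max_card (mem (r :: p')); rewrite (card_uniqP up') /=.
by move/ltn_predK: (leq_ltn_trans (leq0n _) (ltnSn (size p'))); lia.
Qed.

Lemma layer_ltn E j v : v \in Layer E j -> (j < #|V|)%N.
Proof.
case: j => [|j vj]; first by move=> _; apply/card_gt0P; exists v.
rewrite ltnNge; apply/negP => Vj; case/negP: (layerS_notin vj).
apply: (subsetP (ball_le _ _ _ (_ : (#|V|.-1 <= j)%N))); first by lia.
exact: (subsetP (ball_card E j.+1)) (layer_ball vj).
Qed.

Lemma layer_inj E i j v : v \in Layer E i -> v \in Layer E j -> i = j.
Proof.
wlog ij : i j / (i <= j)%N.
  by move=> W; case/orP: (leq_total i j) => ij vi vj; [|apply/esym]; exact: W.
move=> vi; case: j => [|j] in ij *; first by move: ij; rewrite leqn0 => /eqP ->.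
move=> vj; move: ij; rewrite leq_eqVlt => /orP[/eqP //|]; rewrite ltnS => ij.
by case/negP: (layerS_notin vj); exact: (subsetP (ball_le _ _ _ ij)) (layer_ball vi).
Qed.

Lemma bigminn_le (I : eqType) (s : seq I) (P : pred I) (F : I -> nat) m i :
  i \in s -> P i -> (\big[minn/m]_(k <- s | P k) F k <= F i)%N.
Proof.
elim: s => // k s IH; rewrite inE big_cons => /orP[/eqP <- ->|/IH{}IH /IH{}IH].
  exact: geq_minl.
by case: ifP => // _; rewrite (leq_trans (geq_minr _ _)).
Qed.

(** A walk read off the ball of radius [j] bounds the minimum from above; a shorter one would put
    [v] in an earlier ball. The default value [#|V|] of the minimum does not interfere, because
    nonempty layers have index below [#|V|]. *)
Lemma gdist_layer E j v : v \in Layer E j -> gdist E r v = j.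
Proof.
move=> vj; have jV := layer_ltn vj; apply/eqP; rewrite eqn_leq; apply/andP; split.
  have /ball_pathP[p [pp lp sp]] := layer_ball vj.
  have pV : (size p < #|V|)%N by exact: leq_ltn_trans jV.
  apply: leq_trans sp; rewrite /gdist.
  apply: (@bigminn_le _ _ _ (fun k : 'I_#|V| => k : nat) _ (Ordinal pV)).
    exact: mem_index_enum.
  by apply/existsP; exists (in_tuple p); rewrite /= pp lp eqxx.
rewrite /gdist; elim/big_rec: _ => [|k m /existsP[p /andP[pp /eqP lp]] jm]; first exact: ltnW.
rewrite leq_min jm andbT leqNgt; apply/negP => kj.
case: j => [|j] // in vj kj {jm jV} *; case/negP: (layerS_notin vj).
by apply/ball_pathP; exists p; rewrite size_tuple.
Qed.

Lemma connect_layer E v : connect (adj E) r v <-> exists j, v \in Layer E j.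
Proof.
split => [/connectP[p pp ->]|[j /layer_ball /ball_pathP[p [pp <- _]]]].
  have : last r p \in Ball E (size p) by apply/ball_pathP; exists p.
  by case/ball_layer => i _ li; exists i.
by apply/connectP; exists p.
Qed.

Lemma layer_comp E j v : v \in Layer E j -> v \in comp_vertices E r.
Proof. by move=> vj; rewrite inE; apply/connect_layer; exists j. Qed.

Lemma layer0 E : Layer E 0 = [set r].
Proof. by rewrite /layer /=; apply/setP => x; rewrite !inE. Qed.

Lemma comp_layerP E v : v \in comp_vertices E r :\ r <-> exists j, v \in Layer E j.+1.
Proof.
rewrite in_setD1 inE; split => [/andP[vr /connect_layer[[|j] vj]]|[j vj]].
- by rewrite layer0 inE (negPf vr) in vj.
- by exists j.
- apply/andP; split; last by apply/connect_layer; exists j.+1.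
  apply: contraTneq vj => ->; apply/negP => rj.
  by have := layer_inj rj (_ : r \in Layer E 0); rewrite layer0 inE eqxx => /(_ isT).
Qed.

Lemma adj_comp E x y : adj (comp_edges E r) x y =
  [&& adj E x y, x \in comp_vertices E r & y \in comp_vertices E r].
Proof.
by rewrite /adj [_ \in comp_edges _ _]inE subUset !sub1set; case: (x != y); rewrite //= -andbA.
Qed.

Lemma comp_adj E x y : x \in comp_vertices E r -> adj E x y -> y \in comp_vertices E r.
Proof.
by rewrite !inE => rx xy; apply: connect_trans rx _; exact: connect1.
Qed.

Lemma ball_comp_edges E j : Ball (comp_edges E r) j = Ball E j.
Proof.
elim: j => // j IH; apply/setP => v; rewrite !in_ballS IH inE /=.
congr (_ || _); apply: eq_existsb => x; case: (boolP (x \in Ball E j)) => //= xj.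
have [i _ /layer_comp xC] := ball_layer xj.
by rewrite adj_comp xC /=; case: (boolP (adj E x v)) => //= /(comp_adj xC) ->.
Qed.

Lemma layer_comp_edges E j : Layer (comp_edges E r) j = Layer E j.
Proof. by case: j => [|j]; rewrite /layer !ball_comp_edges. Qed.

(** Bounding the level by [#|V|] makes the existential boolean and loses nothing, by [layer_ltn]. *)
Definition parents E v : {set V} :=
  [set u | adj E u v & [exists j : 'I_#|V|, (u \in Layer E j) && (v \in Layer E j.+1)]].

Lemma parents_layer E j v : v \in Layer E j.+1 ->
  parents E v = [set u in Layer E j | adj E u v].
Proof.
move=> vj; apply/setP => u; rewrite !inE andbC; congr (_ && _).
apply/existsP/idP => [[i /andP[ui vi]]|uj].
  by have [ij] := layer_inj vi vj; rewrite -ij.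
by exists (Ordinal (layer_ltn uj)); rewrite /= uj vj.
Qed.

Lemma parentsP E u v : u \in parents E v ->
  exists j, [/\ u \in Layer E j, v \in Layer E j.+1 & adj E u v].
Proof. by rewrite inE => /andP[uv /existsP[j /andP[uj vj]]]; exists j. Qed.

End Distances.

(** * Shortest path trees as independent choices of parents *)

Section ShortestPathTrees.
Variables (V : finType) (r : V) (E : {set {set V}}).
Implicit Types (T : {set {set V}}) (u v x y : V) (p : {ffun V -> V}).
Local Notation Ball E j := (ball r (adj E) set0 j).
Local Notation Layer E j := (layer r (adj E) set0 j).
Local Notation C := (comp_vertices E r).

Definition tree_of p : {set {set V}} := [set [set p v; v] | v in C :\ r].

(** The value is frozen at the root and off its component, so that different maps give different
    trees. *)
Definition parent_maps : {set {ffun V -> V}} :=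
  [set p : {ffun V -> V} | [forall v, if v \in C :\ r then p v \in parents r E v else p v == v]].

Lemma parent_mapP p v : p \in parent_maps -> v \in C :\ r -> p v \in parents r E v.
Proof. by rewrite inE => /forallP /(_ v) + vC; rewrite vC. Qed.

Section Tree.
Variable p : {ffun V -> V}.
Hypothesis pP : forall v, v \in C :\ r -> p v \in parents r E v.

Lemma adj_treeE x y : adj (tree_of p) x y ->
  (y \in C :\ r /\ x = p y) \/ (x \in C :\ r /\ y = p x).
Proof.
case/andP => xy /imsetP[v vC /setP xyv].
have hx := xyv x; have hy := xyv y; rewrite !inE !eqxx ?orbT /= in hx hy.
move: hy hx => /esym/orP[]/eqP yE /esym/orP[]/eqP xE.
- by rewrite xE yE eqxx in xy.
- by right; rewrite xE yE; split.
- by left; rewrite xE yE; split.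
- by rewrite xE yE eqxx in xy.
Qed.

Lemma adj_parent v : v \in C :\ r -> adj (tree_of p) (p v) v.
Proof.
move=> vC; apply/andP; split; last by apply/imsetP; exists v.
by have /parentsP[j [_ _ /andP[]]] := pP vC.
Qed.

Lemma ball_tree j : Ball (tree_of p) j = Ball E j.
Proof.
elim: j => // j IH; apply/setP => v; rewrite !in_ballS IH inE /=.
case: (boolP (v \in Ball E j)) => //= vj; apply/existsP/existsP.
  case=> x /andP[xj /adj_treeE[[vC xE]|[xC vE]]].
    by have /parentsP[i [_ _ apv]] := pP vC; exists x; rewrite xj xE.
  (* An edge from [x] back to its own parent [v] adds nothing: [v] is one layer closer to the root,
     hence already in the ball. *)
  have /parentsP[i [vi xi _]] := pP xC; case/negP: vj; rewrite vE.
  have [i' i'j /(layer_inj xi) ii'] := ball_layer xj.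
  by apply: (subsetP (ball_le _ _ _ (_ : i <= j)%N)) (layer_ball vi); rewrite ltnW // ii'.
case=> x /andP[xj exv]; have vj1 : v \in Layer E j.+1.
  by rewrite /layer in_setD in_ballS (negPf vj) inE /=; apply/existsP; exists x; rewrite xj.
have vC : v \in C :\ r by apply/comp_layerP; exists j.
exists (p v); rewrite adj_parent // andbT.
by have := pP vC; rewrite (parents_layer vj1) inE => /andP[/layer_ball].
Qed.

Lemma layer_tree j : Layer (tree_of p) j = Layer E j.
Proof. by case: j => [|j]; rewrite /layer !ball_tree. Qed.

(** At a vertex of the cycle farthest from the root, both cycle neighbours would have to be its
    parent, but they are distinct. *)
Lemma tree_of_acyclic : acyclic (tree_of p).
Proof.
move=> s s2 /andP[cs us]; pose d v := gdist E r v.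
have s0 : (0 < size s)%N by exact: ltn_trans s2.
have [x0 x0s] : exists x, x \in s by case: s s0 {s2 cs us} => // x s _; exists x; rewrite inE eqxx.
case: (@arg_maxnP _ x0 (mem s) d x0s) => v vs vmax.
have [i s' rs] := rot_to vs.
have rs_s z : z \in v :: s' -> z \in s by rewrite -rs mem_rot.
have up x : x \in s -> adj (tree_of p) v x -> x = p v.
  move=> xs /adj_treeE[[xC vE]|[//]]; have /parentsP[j [vj xj _]] := pP xC.
  have := vmax x xs; rewrite /d (gdist_layer xj); rewrite -vE in vj.
  by rewrite (gdist_layer vj) /=; lia.
have := cs; have := us; have := s2; rewrite -(rot_uniq i) -(rot_cycle i) -(size_rot i) rs.
case: s' rs_s {rs} => // a [|b s'] // rs_s _ us'; rewrite /= rcons_path.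
case/and4P => va _ _ lv.
have aE : a = p v by apply: up va; apply: rs_s; rewrite !inE eqxx orbT.
have lE : last b s' = p v.
  by apply: up; [apply: rs_s; rewrite 2!in_cons mem_last !orbT | rewrite adj_sym].
move: us' => /= /andP[_ /andP[+ _]]; rewrite aE -lE; case/negP; exact: mem_last.
Qed.

Lemma tree_of_spt : shortest_path_tree C (comp_edges E r) r (tree_of p).
Proof.
have rC : r \in C by rewrite inE connect0.
have conn v : v \in C -> connect (adj (tree_of p)) r v.
  by rewrite inE => /connect_layer[j]; rewrite -layer_tree => vj; apply/connect_layer; exists j.
split; last first.
  move=> v; rewrite inE => /connect_layer[j vj].
  by rewrite (gdist_layer (j := j)) ?layer_tree // (gdist_layer (j := j)) ?layer_comp_edges.
split; last exact: tree_of_acyclic.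
  apply/subsetP => _ /imsetP[v vC ->]; have /parentsP[j [pvj vj apv]] := pP vC.
  have : adj (comp_edges E r) (p v) v.
    by rewrite adj_comp apv (layer_comp pvj) (layer_comp vj).
  by case/andP.
move=> x y xC yC; apply: connect_trans (conn y yC).
by rewrite (sym_connect_sym (@adj_sym _ _)) conn.
Qed.

Lemma directed_tree u v : (u, v) \in directed_edges r (tree_of p) ->
  v \in C :\ r /\ u = p v.
Proof.
rewrite inE /= => /andP[/adj_treeE[//|[uC vE]]].
have /parentsP[j [vj uj _]] := pP uC; rewrite -vE in vj.
rewrite -layer_tree in vj; rewrite -layer_tree in uj.
by rewrite (gdist_layer vj) (gdist_layer uj) => /eqP; lia.
Qed.

Lemma card_tree_of : (#|C|.-1 <= #|tree_of p|)%N.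
Proof.
have rC : r \in C by rewrite inE connect0.
rewrite card_in_imset ?(cardsD1 r C) ?rC // => v v' vC v'C /setP vv'.
have /parentsP[j [pvj vj _]] := pP vC; have /parentsP[i [pvi vi _]] := pP v'C.
have := vv' v; rewrite !inE eqxx orbT => /esym/orP[/eqP vE|/eqP //].
have := vv' v'; rewrite !inE eqxx orbT => /orP[/eqP v'E|/eqP //].
rewrite -v'E in pvj; rewrite -vE in pvi.
by have := layer_inj pvi vj; have := layer_inj pvj vi; lia.
Qed.

End Tree.

(** The edge between [v] and [p v] also belongs to the tree of [p']. Either it gives [p v = p' v],
    or it makes [v] the parent of [p v], which the layers forbid. *)
Lemma tree_of_inj : {in parent_maps &, injective tree_of}.
Proof.
move=> p p' pP p'P pp'; apply/ffunP => v.
have := pP; have := p'P; rewrite !inE => /forallP /(_ v) + /forallP /(_ v).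
case: ifP => [vC _ _|_ /eqP -> /eqP -> //].
have := adj_parent (fun x => parent_mapP pP (v := x)) vC; rewrite pp'.
case/adj_treeE => [[_ //]|[pvC vE]].
have /parentsP[j [pvj vj _]] := parent_mapP pP vC.
have /parentsP[i [vi pvi _]] := parent_mapP p'P pvC; rewrite -vE in vi.
by have := layer_inj pvi pvj; have := layer_inj vi vj; lia.
Qed.

Hypothesis E2 : forall e, e \in E -> #|e| = 2.

(** Distances in [T] and [E] agree, so every [v] has a [T]-neighbour in the previous layer. Choosing
    one for each [v] gives a parent map whose tree is connected and contained in [T]; any further
    edge of [T] would close a cycle with it. *)
Lemma spt_tree_of T : shortest_path_tree C (comp_edges E r) r T ->
  exists2 p, p \in parent_maps & T = tree_of p.
Proof.
case=> -[TE Tconn Tacyc] Tdist.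
have rC : r \in C by rewrite inE connect0.
have TadjE x y : adj T x y -> adj (comp_edges E r) x y.
  by rewrite /adj => /andP[-> /(subsetP TE)].
have TL j v : v \in Layer E j -> v \in Layer T j.
  move=> vj; have vC := layer_comp vj; have /connect_layer[i vi] := Tconn r v rC vC.
  have := Tdist v vC; rewrite (gdist_layer vi) (gdist_layer (j := j)) ?layer_comp_edges //.
  by move=> <-.
have LT j v : v \in C -> v \in Layer T j -> v \in Layer E j.
  move=> vC vj; have := vC; rewrite inE => /connect_layer[i vi].
  by rewrite (layer_inj vj (TL _ _ vi)).
pose p : {ffun V -> V} :=
  [ffun v => odflt v [pick u | adj T u v && (u \in parents r E v)]].
have pP v : v \in C :\ r -> adj T (p v) v /\ p v \in parents r E v.
  move=> vC; rewrite ffunE; case: pickP => [u /andP[//]|no].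
  have /comp_layerP[j vj] := vC; have [u uj uv] := layer_pred (TL _ _ vj).
  have := no u; rewrite uv /= (parents_layer vj) inE.
  by have := TadjE _ _ uv; rewrite adj_comp => /and3P[-> uC _]; rewrite (LT _ _ uC uj).
have pM : p \in parent_maps.
  rewrite inE; apply/forallP => v; case: ifP => [/pP[]//|vC].
  rewrite ffunE; case: pickP => [u /andP[_ /parentsP[j [_ vj _]]]|//].
  by rewrite (introT idP (_ : v \in C :\ r)) in vC => //; apply/comp_layerP; exists j.
exists p => //; have pP' := fun v => parent_mapP pM (v := v).
have T0T : tree_of p \subset T.
  by apply/subsetP => _ /imsetP[v /pP[/andP[_ pvT] _] ->].
apply/eqP; rewrite eqEsubset T0T andbT; apply/subsetP => e eT.
have /cards2P[x [y [xy eE]]] : #|e| == 2.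
  by apply/eqP; apply: E2; have := subsetP TE e eT; rewrite inE => /andP[].
have axy : adj T x y by rewrite /adj xy -eE.
apply: contraT => eT0.
have [[_ T0conn _] _] := tree_of_spt pP'.
have := TadjE _ _ axy; rewrite adj_comp => /and3P[_ xC yC].
have /connectP[s ps ys] := T0conn x y xC yC.
case/shortenP: ps ys => s' ps' us' _ ys.
case: (Tacyc (x :: s')); last first.
  rewrite /ucycle us' andbT /= rcons_path -ys adj_sym axy andbT.
  by apply: sub_path ps' => a b /andP[ab abT]; rewrite /adj ab (subsetP T0T).
case: s' ps' us' ys => [|a [|b s']] //=.
  by move=> _ _ yx; rewrite yx eqxx in xy.
rewrite andbT => /andP[_ xa] _ ya; case/negP: eT0.
by rewrite eE ya.
Qed.

Lemma comp_sptsE : comp_spts E r = tree_of @: parent_maps.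
Proof.
apply/setP => T; rewrite inE; apply/asboolP/imsetP.
  by case/spt_tree_of => p; exists p.
by case=> p pM ->; apply: tree_of_spt => v; exact: parent_mapP.
Qed.

Lemma card_comp_spt T : T \in comp_spts E r -> (#|C|.-1 <= #|T|)%N.
Proof.
rewrite comp_sptsE => /imsetP[p pM ->]; apply: card_tree_of => v; exact: parent_mapP.
Qed.

(** The choice at [v] is free: overwriting [p v] by [u'] injects the maps with value [u] at [v] into
    those with value [u'], and these classes are disjoint for different [u']. *)
Lemma card_parent_maps u v : u \in parents r E v ->
  (#|parents r E v| * #|[set p : {ffun V -> V} in parent_maps | p v == u]| <= #|parent_maps|)%N.
Proof.
move=> uv; have vC : v \in C :\ r by have /parentsP[j [_ vj _]] := uv; apply/comp_layerP; exists j.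
have swap u' : u' \in parents r E v ->
    (#|[set p : {ffun V -> V} in parent_maps | p v == u]| <= #|[set p : {ffun V -> V} in parent_maps | p v == u']|)%N.
  move=> u'v; pose f (p : {ffun V -> V}) : {ffun V -> V} := [ffun x => if x == v then u' else p x].
  rewrite -(card_in_imset (f := f)).
    apply: subset_leq_card; apply/subsetP => _ /imsetP[p /setIdP[pM _] ->].
    apply/setIdP; rewrite ffunE !eqxx; split => //; rewrite inE; apply/forallP => x.
    rewrite ffunE; case: eqP => [->|_]; first by rewrite vC.
    by move: pM; rewrite inE => /forallP.
  move=> p p' /setIdP[_ /eqP pv] /setIdP[_ /eqP p'v] /ffunP ff.
  by apply/ffunP => x; have := ff x; rewrite !ffunE; case: eqP => // ->; rewrite pv p'v.
rewrite -sum_nat_const; apply: leq_trans (leq_sum _ swap) _.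
rewrite (eq_bigr (fun u' => \sum_(p in parent_maps) (p v == u' : nat)))%N; last first.
  move=> u' _; rewrite -sum1_card [LHS]big_mkcond [RHS]big_mkcond /=; apply: eq_bigr => p _.
  by rewrite inE; case: (p \in parent_maps); case: eqP.
rewrite exchange_big /= -sum1_card; apply: leq_sum => p _.
rewrite big_mkcond /= (bigD1 (p v)) //= big1 => [|x xp]; last by rewrite eq_sym (negPf xp); case: ifP.
by rewrite addn0 eqxx; case: ifP.
Qed.

Local Open Scope ring_scope.

(** A uniform shortest path tree is the tree of a uniform parent map, whose value at [v] is uniform
    on the possible parents. *)
Lemma parent_prob (R : realType) u v :
  \sum_T unif_pmf R (comp_spts E r) T * ((u, v) \in directed_edges r T)%:R <=
  (u \in parents r E v)%:R / #|parents r E v|%:R.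
Proof.
pose S := [set T in comp_spts E r | (u, v) \in directed_edges r T].
have -> : \sum_T unif_pmf R (comp_spts E r) T * ((u, v) \in directed_edges r T)%:R =
    #|S|%:R / #|comp_spts E r|%:R.
  rewrite (natr_card R S) mulr_suml; apply: eq_bigr => T _.
  rewrite /unif_pmf [T \in S]inE; case: (T \in _); rewrite ?mul0r //=.
  by case: (_ \in directed_edges _ _); rewrite ?mulr1 ?mulr0 ?mul0r.
have SP : S \subset tree_of @: [set p : {ffun V -> V} in parent_maps | (p v == u) && (u \in parents r E v)].
  apply/subsetP => T; rewrite inE comp_sptsE => /andP[/imsetP[p pM ->]].
  case/directed_tree => [x|vC uE]; first exact: parent_mapP.
  by apply: imset_f; rewrite [_ \in finset _]inE pM uE eqxx /=; exact: parent_mapP.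
case: (boolP (u \in parents r E v)) SP => uP SP; last first.
  rewrite mul0r (_ : S = set0) ?cards0 ?mul0r //; apply/setP => T; rewrite [RHS]inE.
  by apply: contraNF uP => /(subsetP SP) /imsetP[p]; rewrite inE => /and3P[].
have p0 : (0 < #|parents r E v|)%N by apply/card_gt0P; exists u.
have [s0|s0] := posnP #|comp_spts E r|; first by rewrite s0 invr0 mulr0 divr_ge0.
rewrite ler_pdivlMr ?ltr0n // mulrAC ler_pdivrMr ?ltr0n // mul1r -natrM ler_nat.
rewrite comp_sptsE card_in_imset; last exact: tree_of_inj.
apply: leq_trans (card_parent_maps uP); rewrite mulnC leq_mul2l; apply/orP; right.
apply: leq_trans (subset_leq_card SP) _; apply: leq_trans (leq_imset_card _ _) _.
by apply: subset_leq_card; apply/subsetP => p; rewrite !inE andbT.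
Qed.

End ShortestPathTrees.

Local Open Scope ring_scope.

(** * Product measures and random graphs *)

Section ProductMeasure.
Variables (R : realType) (I T : finType) (mu : T -> R).
Hypothesis mu_ge0 : forall t, 0 <= mu t.
Hypothesis mu_sum : \sum_t mu t = 1.
Implicit Types (w : {ffun I -> T}) (f : {ffun I -> T} -> R) (h : T -> R).

Definition prod_pmf w : R := \prod_i mu (w i).

Definition Ex f : R := \sum_w prod_pmf w * f w.

Definition mean h : R := \sum_t mu t * h t.

Definition upd w i t : {ffun I -> T} := [ffun k => if k == i then t else w k].

Lemma prod_pmf_ge0 w : 0 <= prod_pmf w.
Proof. exact: prodr_ge0. Qed.

Lemma Ex_le f f' : (forall w, f w <= f' w) -> Ex f <= Ex f'.
Proof.
by move=> ff'; apply: ler_sum => w _; rewrite ler_wpM2l // prod_pmf_ge0.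
Qed.

Lemma Ex_ge0 f : (forall w, 0 <= f w) -> 0 <= Ex f.
Proof. by move=> f0; apply: sumr_ge0 => w _; rewrite mulr_ge0 ?prod_pmf_ge0. Qed.

Lemma eq_Ex f f' : f =1 f' -> Ex f = Ex f'.
Proof. by move=> ff'; apply: eq_bigr => w _; rewrite ff'. Qed.

Lemma ExD f f' : Ex (fun w => f w + f' w) = Ex f + Ex f'.
Proof. by rewrite -big_split; apply: eq_bigr => w _; rewrite mulrDr. Qed.

Lemma ExZ c f : Ex (fun w => c * f w) = c * Ex f.
Proof. by rewrite mulr_sumr; apply: eq_bigr => w _; rewrite mulrCA. Qed.

Lemma ExB f f' : Ex (fun w => f w - f' w) = Ex f - Ex f'.
Proof. by rewrite -sumrB; apply: eq_bigr => w _; rewrite mulrBr. Qed.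

Lemma Ex_sum (J : Type) (s : seq J) (P : pred J) (F : J -> {ffun I -> T} -> R) :
  Ex (fun w => \sum_(j <- s | P j) F j w) = \sum_(j <- s | P j) Ex (F j).
Proof.
rewrite /Ex exchange_big /=; apply: eq_bigr => w _.
by rewrite mulr_sumr.
Qed.

Lemma Ex_cst c : Ex (fun=> c) = c.
Proof.
rewrite /Ex -mulr_suml /prod_pmf -(bigA_distr_bigA (fun=> mu)) /=.
by rewrite big1 ?mul1r.
Qed.

Lemma Ex_markov (a : R) f (P : pred {ffun I -> T}) : 0 < a ->
  (forall w, 0 <= f w) -> (forall w, P w -> a <= f w) ->
  Ex (fun w => (P w)%:R) <= a^-1 * Ex f.
Proof.
move=> a0 f0 Pf; rewrite -ExZ; apply: Ex_le => w.
case: (boolP (P w)) => /= [/Pf|_]; last by rewrite mulr_ge0 ?invr_ge0 ?(ltW a0).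
by move=> ?; rewrite mulrC ler_pdivlMr // mul1r.
Qed.

(** Exchanging the coordinate [w i] with an independent fresh copy is an involution that preserves
    the product weight. *)
Lemma Ex_resample i f : Ex f = Ex (fun w => \sum_t mu t * f (upd w i t)).
Proof.
have pmfD w : prod_pmf w = mu (w i) * \prod_(k | k != i) mu (w k).
  by rewrite /prod_pmf (bigD1 i).
transitivity (\sum_(p : {ffun I -> T} * T)
    prod_pmf p.1 * (mu p.2 * f (upd p.1 i p.2))); last first.
  rewrite -(pair_bigA _ (fun w t => prod_pmf w * (mu t * f (upd w i t)))) /=.
  by apply: eq_bigr => w _; rewrite mulr_sumr.
transitivity (\sum_(p : {ffun I -> T} * T) prod_pmf p.1 * (mu p.2 * f p.1)).
  rewrite -(pair_bigA _ (fun w t => prod_pmf w * (mu t * f w))) /=.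
  by apply: eq_bigr => w _; rewrite -mulr_sumr -mulr_suml mu_sum mul1r.
pose swap (p : {ffun I -> T} * T) := (upd p.1 i p.2, p.1 i).
have swapK : involutive swap.
  case=> w t; rewrite /swap /=; congr pair; last by rewrite ffunE eqxx.
  by apply/ffunP => k; rewrite !ffunE; case: eqP => [->|].
rewrite (reindex_inj (inv_inj swapK)) /=; apply: eq_bigr => -[w t] _ /=.
rewrite !pmfD ffunE eqxx (eq_bigr (fun k => mu (w k))); last first.
  by move=> k ki; rewrite ffunE (negPf ki).
by ring.
Qed.

Lemma Ex_indep i f h : (forall w t, f (upd w i t) = f w) ->
  Ex (fun w => f w * h (w i)) = Ex f * mean h.
Proof.
move=> fi; rewrite (Ex_resample i) mulrC -ExZ; apply: eq_Ex => w.
rewrite mulr_suml; apply: eq_bigr => t _.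
by rewrite fi ffunE eqxx mulrCA mulrC.
Qed.

End ProductMeasure.

Arguments Ex_cst {R I T mu}.

(** * Random graphs on the product space and independence of edges *)

Section RandomGraph.
Variables (R : realType) (V T : finType) (mu : T -> R).
Hypothesis mu_ge0 : forall t, 0 <= mu t.
Hypothesis mu_sum : \sum_t mu t = 1.
Local Notation space := {ffun vpair V -> T}.
Implicit Types (g : T -> bool) (w : space) (f : space -> R) (x y u v : V) (U : {set V}) (j : nat).

Definition rgraph_adj g w : rel V :=
  adj [set val i | i in [set i : vpair V | g (w i)]].

Definition eprob g : R := mean mu (fun t => (g t)%:R).

(** Independence from the edges at [v], expressed as invariance under changing any one pair that
    contains [v]. *)
Definition avoids v (A : Type) (f : space -> A) :=
  forall (i : vpair V) w t, v \in val i -> f (upd w i t) = f w.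

Lemma vpair_subproof x y : x != y -> #|[set x; y]| == 2.
Proof. by move=> xy; rewrite cards2 xy. Qed.

Definition mkpair x y (xy : x != y) : vpair V :=
  exist _ [set x; y] (vpair_subproof xy).

Lemma rgraph_adjE g w x y (xy : x != y) :
  rgraph_adj g w x y = g (w (mkpair xy)).
Proof.
rewrite /rgraph_adj /adj xy /=; apply/imsetP/idP => [[i]|gi].
  by rewrite inE => gi xyi; rewrite (_ : mkpair xy = i) //; apply: val_inj.
by exists (mkpair xy) => //; rewrite inE.
Qed.

Lemma rgraph_adj_irr g w x : rgraph_adj g w x x = false.
Proof. by rewrite /rgraph_adj /adj eqxx. Qed.

Lemma rgraph_adjI g g' w x y :
  rgraph_adj g w x y && rgraph_adj g' w x y = rgraph_adj (fun t => g t && g' t) w x y.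
Proof.
have [->|xy] := eqVneq x y; first by rewrite !rgraph_adj_irr.
by rewrite !(rgraph_adjE _ _ xy).
Qed.

Lemma rgraph_adj_upd g w i t x y : val i != [set x; y] ->
  rgraph_adj g (upd w i t) x y = rgraph_adj g w x y.
Proof.
have [->|xy] := eqVneq x y; first by rewrite !rgraph_adj_irr.
move=> ixy; rewrite !(rgraph_adjE _ _ xy) ffunE.
by rewrite (_ : mkpair xy == i = false) //; apply: contraNF ixy => /eqP <-.
Qed.

Lemma avoids_adj g v x y : x != v -> y != v ->
  avoids v (fun w => rgraph_adj g w x y).
Proof.
move=> xv yv i w t vi; apply: rgraph_adj_upd; apply: contraTneq vi => ->.
by rewrite !inE negb_or eq_sym xv eq_sym yv.
Qed.

Lemma ball_upd r g U j v (i : vpair V) w t : v \in U -> v \in val i ->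
  ball r (rgraph_adj g (upd w i t)) U j = ball r (rgraph_adj g w) U j.
Proof.
move=> vU vi; apply: ball_ext => x y xU yU; apply: (@avoids_adj g v x y) => //.
  by apply: contraNneq xU => ->.
by apply: contraNneq yU => ->.
Qed.

Lemma layer_upd r g U j v (i : vpair V) w t : v \in U -> v \in val i ->
  layer r (rgraph_adj g (upd w i t)) U j = layer r (rgraph_adj g w) U j.
Proof.
move=> vU vi; apply: layer_ext => x y xU yU; apply: (@avoids_adj g v x y) => //.
  by apply: contraNneq xU => ->.
by apply: contraNneq yU => ->.
Qed.

Lemma Ex_edge g v x f : avoids v f -> x != v ->
  Ex mu (fun w => f w * (rgraph_adj g w x v)%:R) = Ex mu f * eprob g.
Proof.
move=> fv xv; rewrite -(Ex_indep mu_sum (i := mkpair xv)).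
  by apply: eq_Ex => w; rewrite rgraph_adjE.
by move=> w t; apply: fv; rewrite /= !inE eqxx orbT.
Qed.

Lemma Ex_edge2 g g' v v' x x' f : avoids v f -> avoids v' f ->
  x != v -> x' != v' -> [set x; v] != [set x'; v'] ->
  Ex mu (fun w => f w * ((rgraph_adj g w x v)%:R * (rgraph_adj g' w x' v')%:R)) =
  Ex mu f * (eprob g * eprob g').
Proof.
move=> fv fv' xv xv' neq; rewrite mulrA -(Ex_edge g fv xv).
rewrite -(Ex_indep mu_sum (i := mkpair xv')).
  by apply: eq_Ex => w; rewrite -mulrA (rgraph_adjE g').
move=> w t; rewrite rgraph_adj_upd /=; last by rewrite eq_sym.
by rewrite fv' //= !inE eqxx orbT.
Qed.

(** Since [A] and [B] are disjoint, the pairs between them are all different, and their factors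
    split off one at a time. *)
Lemma Ex_edges g (h : bool -> R) (A B : {set V}) f : [disjoint A & B] ->
  (forall v, v \in B -> avoids v f) ->
  Ex mu (fun w => f w * \prod_(x in A) \prod_(v in B) h (rgraph_adj g w x v)) =
  Ex mu f * mean mu (fun t => h (g t)) ^+ (#|A| * #|B|).
Proof.
move=> dAB fB; pose s := enum (setX A B).
have -> : (#|A| * #|B|)%N = size s by rewrite -cardE cardsX.
transitivity (Ex mu (fun w => f w * \prod_(p <- s) h (rgraph_adj g w p.1 p.2))).
  apply: eq_Ex => w; congr (_ * _).
  rewrite (pair_big (mem A) (mem B) (fun x v => h (rgraph_adj g w x v))) /=.
  by rewrite big_enum; apply: eq_bigl => -[x v]; rewrite inE.
have : {subset s <= setX A B} by move=> p; rewrite mem_enum.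
have : uniq s by exact: enum_uniq.
elim: s => [|[x v] s IH] /= => [_ _|/andP[ps us] sAB].
  by rewrite expr0 mulr1; apply: eq_Ex => w; rewrite big_nil mulr1.
have /setXP /= [xA vB] : (x, v) \in setX A B by apply: sAB; rewrite inE eqxx.
have xv : x != v by apply: contraTneq xA => ->; rewrite (disjointFl dAB vB).
rewrite exprSr mulrA -IH //; last by move=> p ps'; apply: sAB; rewrite inE ps' orbT.
rewrite -(Ex_indep mu_sum (i := mkpair xv)).
  by apply: eq_Ex => w; rewrite big_cons /= (rgraph_adjE _ _ xv) -mulrA;
     congr (_ * _); rewrite mulrC.
move=> w t; rewrite (fB v) //= ?inE ?eqxx ?orbT //; congr (_ * _).
apply: eq_big_seq => -[y u] yus; rewrite rgraph_adj_upd //=.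
have /setXP /= [yA uB] : (y, u) \in setX A B by apply: sAB; rewrite inE yus orbT.
apply: contraNneq ps => E.
have : x \in [set y; u] by rewrite -E !inE eqxx.
have : v \in [set y; u] by rewrite -E !inE eqxx orbT.
rewrite !inE => /orP[/eqP vy|/eqP ->].
  by move: (disjointFr dAB yA); rewrite -vy vB.
case/orP=> [/eqP -> //|/eqP xu].
by move: (disjointFr dAB xA); rewrite xu uB.
Qed.

End RandomGraph.

(** * Moments of the layers *)

Lemma ler_bool (R : realType) (b c : bool) : (b -> c) -> b%:R <= c%:R :> R.
Proof. by case: b => // /(_ isT) ->. Qed.

Lemma ler_sum_term (R : realType) (V : finType) (F : V -> R) x :
  (forall y, 0 <= F y) -> F x <= \sum_y F y.
Proof. by move=> F0; rewrite (bigD1 x) //= lerDl sumr_ge0. Qed.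

Lemma card_sqr (R : realType) (V : finType) (A : {set V}) :
  #|A|%:R ^+ 2 = \sum_x \sum_y (x \in A)%:R * (y \in A)%:R :> R.
Proof. by rewrite expr2 natr_card mulr_suml; apply: eq_bigr => x _; rewrite mulr_sumr. Qed.

Section Moments.
Variables (R : realType) (V T : finType) (mu : T -> R) (r : V).
Hypothesis mu_ge0 : forall t, 0 <= mu t.
Hypothesis mu_sum : \sum_t mu t = 1.
Variable g : T -> bool.
Local Notation space := {ffun vpair V -> T}.
Implicit Types (w : space) (f : space -> R) (x y u v : V) (U : {set V}) (j : nat).

Local Notation q := (eprob mu g).
Local Notation D := (#|V|%:R * q).
Local Notation E := (rgraph_adj g).
Local Notation Ball U j w := (ball r (E w) U j).
Local Notation Layer U j w := (layer r (E w) U j).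
Local Notation EX := (Ex mu).

Lemma eprob_ge0 : 0 <= q.
Proof. by apply: sumr_ge0 => t _; rewrite mulr_ge0. Qed.

Lemma layer_notin U j v w : v \in U -> (v \in Layer U j w) = false.
Proof. by move=> vU; apply: contraTF vU => /layer_ball /ball_notin. Qed.

Lemma Ex_layer_edge U j x v :
  EX (fun w => (x \in Layer (v |: U) j w)%:R * (E w x v)%:R) =
  EX (fun w => (x \in Layer (v |: U) j w)%:R) * q.
Proof.
have [->|xv] := eqVneq x v.
  rewrite [X in _ = X * _](eq_Ex _ (f' := fun=> 0)).
    rewrite (Ex_cst mu_sum) mul0r -[RHS](Ex_cst (I := vpair V) mu_sum).
    by apply: eq_Ex => w; rewrite layer_notin ?mul0r // !inE eqxx.
  by move=> w; rewrite layer_notin // !inE eqxx.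
apply: Ex_edge => // i w t vi.
by rewrite (layer_upd _ _ _ _ _ _ vi) // !inE eqxx.
Qed.

(** A vertex [v] of layer [j + 1] has a predecessor in layer [j] of the graph without [v], and the
    connecting edge is independent of that layer. Summing over [v] yields one factor [D] per
    level. *)
Lemma Ex_card_layer U j : EX (fun w => #|Layer U j w|%:R) <= D ^+ j.
Proof.
elim: j U => [|j IH] U.
  rewrite expr0 -[leRHS](Ex_cst (I := vpair V) mu_sum); apply: Ex_le => // w.
  by rewrite lern1 -(cards1 r); apply: subset_leq_card; rewrite subDset subsetUr.
rewrite (eq_Ex _ (f' := fun w => \sum_v (v \in Layer U j.+1 w)%:R)); last first.
  by move=> w; exact: natr_card.
rewrite Ex_sum; apply: (@le_trans _ _ (\sum_(v : V) q * D ^+ j)); last first.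
  by rewrite sumr_const -[leLHS]mulr_natl exprS mulrA.
apply: ler_sum => v _.
apply: (@le_trans _ _ (EX (fun w =>
    \sum_x (x \in Layer (v |: U) j w)%:R * (E w x v)%:R))).
  apply: Ex_le => // w; case: (boolP (v \in _)) => /= [vL|_]; last first.
    by apply: sumr_ge0 => x _; rewrite mulr_ge0 ?ler0n.
  have [x xL exv] := layer_pred vL.
  apply: le_trans (ler_sum_term x _); last by move=> y; rewrite mulr_ge0 ?ler0n.
  by rewrite layer_remove ?disjoints1 ?layerS_notin // xL exv mulr1.
rewrite Ex_sum (eq_bigr _ (fun x _ => Ex_layer_edge U j x v)) -mulr_suml.
rewrite mulrC ler_wpM2l ?eprob_ge0 // -Ex_sum; apply: le_trans (IH (v |: U)).
by apply: Ex_le => // w; rewrite natr_card.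
Qed.

(** The second moment is at most [D^j + ... + D^(2 j)], as for a branching process with Poisson
    offspring of mean [D]; the factor [D - 1] sums this geometric series. The diagonal contributes
    the first moment, which gives the recursion [s(j+1) <= D^2 s(j) + D^(j+1)]. *)
Lemma Ex_card_layer_sqr U j : 1 <= D ->
  (D - 1) * EX (fun w => #|Layer U j w|%:R ^+ 2) <= D ^+ (2 * j).+1 - D ^+ j.
Proof.
move=> D1; elim: j U => [|j IH] U.
  rewrite muln0 expr1 expr0 -[leRHS]mulr1 ler_wpM2l ?subr_ge0 //.
  rewrite -[leRHS](Ex_cst (I := vpair V) mu_sum); apply: Ex_le => // w.
  rewrite -natrX lern1 -(exp1n 2) leq_exp2r // -(cards1 r).
  by apply: subset_leq_card; rewrite subDset subsetUr.
set s := (D ^+ (2 * j).+1 - D ^+ j) in IH.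
have D0 : 0 <= D by apply: le_trans D1.
have q0 := eprob_ge0.
pose F v u w := (v \in Layer U j.+1 w)%:R * (u \in Layer U j.+1 w)%:R : R.
(* Both vertices are deleted, so the edges to their predecessors are independent of the layer and,
   being different edges, of each other. *)
have off v u : v != u -> (D - 1) * EX (F v u) <= q ^+ 2 * s.
  move=> vu; pose U' := [set v; u] :|: U.
  have vU' : v \in U' by rewrite !inE eqxx.
  have uU' : u \in U' by rewrite !inE eqxx orbT.
  apply: (@le_trans _ _ ((D - 1) * EX (fun w => \sum_x \sum_y
      ((x \in Layer U' j w)%:R * (y \in Layer U' j w)%:R) *
      ((E w x v)%:R * (E w y u)%:R)))).
    rewrite ler_wpM2l ?subr_ge0 //; apply: Ex_le => // w; rewrite /F.
    case: (boolP (v \in _)) => /= [vL|_]; last first.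
      by rewrite mul0r; do 2!(apply: sumr_ge0 => ? _); rewrite !mulr_ge0.
    case: (boolP (u \in _)) => /= [uL|_]; last first.
      by rewrite mulr0; do 2!(apply: sumr_ge0 => ? _); rewrite !mulr_ge0.
    have [x xL exv] := layer_pred vL; have [y yL eyu] := layer_pred uL.
    apply: le_trans (ler_sum_term x _); last first.
      by move=> ?; apply: sumr_ge0 => ? _; rewrite !mulr_ge0.
    apply: le_trans (ler_sum_term y _); last by move=> ?; rewrite !mulr_ge0.
    rewrite layer_remove ?xL ?yL ?exv ?eyu ?mulr1 //.
    rewrite disjoint_subset; apply/subsetP => z; rewrite !inE => /orP[] /eqP ->;
      exact: layerS_notin.
  rewrite (_ : EX _ = q ^+ 2 * EX (fun w => #|Layer U' j w|%:R ^+ 2)).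
    by rewrite mulrCA ler_wpM2l ?exprn_ge0.
  rewrite (eq_Ex _ (fun w => card_sqr R (Layer U' j w))) !Ex_sum mulr_sumr.
  apply: eq_bigr => x _; rewrite !Ex_sum mulr_sumr; apply: eq_bigr => y _.
  case: (boolP (x \in U')) => xU'.
    rewrite [in LHS](eq_Ex _ (f' := fun=> 0)); last first.
      by move=> w; rewrite layer_notin ?mul0r.
    rewrite [in RHS](eq_Ex _ (f' := fun=> 0)); last first.
      by move=> w; rewrite layer_notin ?mul0r.
    by rewrite !(Ex_cst mu_sum) mulr0.
  case: (boolP (y \in U')) => yU'.
    rewrite [in LHS](eq_Ex _ (f' := fun=> 0)); last first.
      by move=> w; rewrite (layer_notin _ _ yU') ?mulr0 ?mul0r.
    rewrite [in RHS](eq_Ex _ (f' := fun=> 0)); last first.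
      by move=> w; rewrite (layer_notin _ _ yU') ?mulr0.
    by rewrite !(Ex_cst mu_sum) mulr0.
  rewrite (Ex_edge2 mu_sum) 1?mulrC //.
  - by move=> i w t vi; rewrite !(layer_upd _ _ _ _ _ vU' vi).
  - by move=> i w t vi; rewrite !(layer_upd _ _ _ _ _ uU' vi).
  - by apply: contraNneq xU' => ->.
  - by apply: contraNneq yU' => ->.
  - apply/eqP => /setP /(_ v); rewrite !inE eqxx orbT (negPf vu) orbF => /esym /eqP.
    by move=> vy; rewrite -vy vU' in yU'.
have diag : \sum_v EX (F v v) <= D ^+ j.+1.
  apply: le_trans (Ex_card_layer U j.+1); rewrite -Ex_sum; apply: Ex_le => // w.
  rewrite natr_card; apply: ler_sum => v _; rewrite /F.
  by case: (v \in _); rewrite ?mulr1 ?mulr0.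
rewrite (eq_Ex _ (fun w => card_sqr R (Layer U j.+1 w))) !Ex_sum.
rewrite (eq_bigr (fun v => EX (F v v) + \sum_(u | u != v) EX (F v u))); last first.
  by move=> v _; rewrite Ex_sum (bigD1 v).
rewrite big_split /= mulrDr.
have bnd : (D - 1) * \sum_v \sum_(u | u != v) EX (F v u) <= D ^+ 2 * s.
  rewrite mulr_sumr; apply: (@le_trans _ _ (\sum_(v : V) \sum_(u : V) q ^+ 2 * s)).
    apply: ler_sum => v _; rewrite mulr_sumr big_mkcond /=.
    apply: ler_sum => u _; case: ifP => [uv|_]; first by rewrite off // eq_sym.
    rewrite mulr_ge0 ?exprn_ge0 // /s subr_ge0 ler_weXn2l //; lia.
  rewrite !sumr_const -[leLHS]mulr_natr -[X in X * _ <= _]mulr_natr le_eqVlt; apply/orP; left; apply/eqP; ring.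
apply: (le_trans (lerD (ler_wpM2l _ diag) bnd)); first by rewrite subr_ge0.
rewrite /s mulnS !exprS le_eqVlt; apply/orP; left; apply/eqP; ring.
Qed.

End Moments.

(** * Second moment of the balls and lower bound for the mean layer size *)

Section MomentBounds.
Variables (R : realType) (V T : finType) (mu : T -> R) (r : V).
Hypothesis mu_ge0 : forall t, 0 <= mu t.
Hypothesis mu_sum : \sum_t mu t = 1.
Local Notation space := {ffun vpair V -> T}.
Implicit Types (w : space) (f : space -> R) (x y u v : V) (U : {set V}) (j : nat).
Implicit Types g : T -> bool.

Local Notation D g := (#|V|%:R * eprob mu g).
Local Notation Ball g U j w := (ball r (rgraph_adj g w) U j).
Local Notation Layer g U j w := (layer r (rgraph_adj g w) U j).
Local Notation EX := (Ex mu).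

Lemma Ex_card_layer_sqr_le2 g U j : 2 <= D g ->
  EX (fun w => #|Layer g U j w|%:R ^+ 2) <= 2 * D g ^+ (2 * j).
Proof.
move=> D2; have D1 : 1 < D g by apply: lt_le_trans D2; rewrite ltr1n.
have := Ex_card_layer_sqr r mu_ge0 mu_sum U j (ltW D1).
have D0 : 0 <= D g by rewrite (le_trans _ (ltW D1)).
have := exprn_ge0 j D0; have := exprn_ge0 (2 * j)%N D0; rewrite exprS.
set s := EX _; set a := D g ^+ (2 * j); set b := D g ^+ j => a0 b0 H.
rewrite -(ler_pM2l (x := D g - 1)) ?subr_gt0 //; nra.
Qed.

(** The square of ball plus layer is at most twice the sum of the squares, and the constant 8
    reproduces itself because [2 * 8 + 2 * 2 * D^2 <= 8 * D^2] for [D >= 2]. *)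
Lemma Ex_card_ball_sqr g U j : 2 <= D g ->
  EX (fun w => #|Ball g U j w|%:R ^+ 2) <= 8 * D g ^+ (2 * j).
Proof.
move=> D2; elim: j => [|j IH].
  have := Ex_card_layer_sqr_le2 U 0 D2.
  by rewrite muln0 expr0 !mulr1 => /le_trans; apply; rewrite ler_nat.
have L := Ex_card_layer_sqr_le2 U j.+1 D2.
have a0 : 0 <= D g ^+ (2 * j) by rewrite exprn_ge0 // (le_trans _ D2).
apply: (@le_trans _ _ (EX (fun w => 2 * #|Ball g U j w|%:R ^+ 2 +
                                    2 * #|Layer g U j.+1 w|%:R ^+ 2))).
  apply: Ex_le => // w; rewrite ball_layerU.
  set a := #|Ball g U j w|; set b := #|Layer g U j.+1 w|.
  apply: (@le_trans _ _ ((a%:R + b%:R) ^+ 2)).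
    by rewrite -natrD -!natrX ler_nat leq_exp2r // leq_card_setU.
  by have := sqr_ge0 (a%:R - b%:R : R); nra.
rewrite ExD !ExZ; move: L IH a0; rewrite mulnS !exprS.
set a := D g ^+ (2 * j); set s := EX _; set s' := EX _ => L IH a0.
have : 4 * a <= D g * (D g * a) by rewrite mulrA ler_wpM2r //; nra.
lra.
Qed.

Lemma Ex_edge2_le g g' v x y f : avoids v f -> (forall w, 0 <= f w) -> x != y ->
  EX (fun w => f w * ((rgraph_adj g w x v)%:R * (rgraph_adj g' w y v)%:R)) <=
  EX f * (eprob mu g * eprob mu g').
Proof.
move=> fv f0 xy.
have q0 g1 : 0 <= eprob mu g1 by exact: eprob_ge0.
have [->|xv] := eqVneq x v.
  rewrite (eq_Ex _ (f' := fun=> 0)) ?(Ex_cst mu_sum) ?mulr_ge0 ?Ex_ge0 //.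
  by move=> w; rewrite rgraph_adj_irr mul0r mulr0.
have [->|yv] := eqVneq y v.
  rewrite (eq_Ex _ (f' := fun=> 0)) ?(Ex_cst mu_sum) ?mulr_ge0 ?Ex_ge0 //.
  by move=> w; rewrite rgraph_adj_irr !mulr0.
rewrite (Ex_edge2 mu_sum) //; apply/eqP => /setP /(_ x).
by rewrite !inE eqxx (negPf xy) (negPf xv).
Qed.

(** A Bonferroni bound. If [v] has a single neighbour in the ball without [v], and it lies in layer
    [j], then [layer_intro] applies. If there is a second one, every term of the first sum is offset
    by a pair, so the left side is at most 0; without neighbours in layer [j] it vanishes. *)
Lemma layer_indicator_ge g w U j v : v \notin U -> v != r ->
  \sum_x (x \in Layer g (v |: U) j w)%:R * (rgraph_adj g w x v)%:R -
  \sum_x \sum_(y | y != x)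
    ((x \in Layer g (v |: U) j w)%:R * (y \in Ball g (v |: U) j w)%:R) *
    ((rgraph_adj g w x v)%:R * (rgraph_adj g w y v)%:R) <=
  (v \in Layer g U j.+1 w)%:R :> R.
Proof.
move=> vU vr; pose P x := (x \in Layer g (v |: U) j w) && rgraph_adj g w x v.
pose Q x := (x \in Ball g (v |: U) j w) && rgraph_adj g w x v.
have PQ x : P x -> Q x by case/andP => xL exv; rewrite /Q layer_ball.
rewrite (eq_bigr (fun x => (P x)%:R)); last by move=> x _; rewrite /P -mulnb natrM.
rewrite [X in _ - X](eq_bigr (fun x => \sum_(y | y != x) (P x)%:R * (Q y)%:R)); last first.
  by move=> x _; apply: eq_bigr => y _; rewrite /P /Q -!mulnb !natrM mulrACA.
rewrite -sumrB.
case: (pickP P) => [x0 Px0|P0]; last first.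
  rewrite big1 // => x _; rewrite P0 sub0r big1 ?oppr0 // => y _; exact: mul0r.
case: (pickP (fun y => (y != x0) && Q y)) => [y0 /andP[yx Qy0]|noQ]; last first.
  have vL : v \in Layer g U j.+1 w.
    case/andP: Px0 => xL exv; apply: (layer_intro vU vr xL exv) => y yB eyv.
    by apply/eqP; apply: contraFT (noQ y) => ->; rewrite /Q yB eyv.
  rewrite vL (bigD1 x0) //= [X in _ + X]big1 => [|x xx0]; last first.
    have -> : P x = false by apply: contraFF (noQ x) => /PQ ->; rewrite xx0.
    by rewrite sub0r big1 ?oppr0 // => y _; exact: mul0r.
  rewrite addr0 Px0 lerBlDr lerDl; apply: sumr_ge0 => y _.
  by rewrite mulr_ge0 ?ler0n.
apply: (@le_trans _ _ 0); last exact: ler0n.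
apply: sumr_le0 => x _; rewrite subr_le0 -mulr_sumr ler_peMr ?ler0n //.
case: (eqVneq x y0) => [->|xy].
  rewrite (bigD1 x0) 1?eq_sym //= PQ // lerDl; apply: sumr_ge0 => *; exact: ler0n.
rewrite (bigD1 y0) 1?eq_sym //= Qy0 lerDl; apply: sumr_ge0 => *; exact: ler0n.
Qed.

(** Each level deletes one more vertex, hence the invariant [#|U| + j <= m]. A level loses at most a
    fraction [m / n] of the candidates (the root and the deleted vertices) and a collision term
    [8 q^2 D^(2 j)] per vertex, which the constant 16 absorbs because [16 D + 8 D^2 <= 16 D^2]. The
    condition on [m * m] keeps [1 - j m / n] nonnegative. *)
Lemma Ex_card_layer_ge g U j (m : nat) : 2 <= D g -> r \notin U ->
  (#|U| + j <= m)%N -> (m * m <= #|V|)%N ->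
  D g ^+ j * (1 - j%:R * m%:R / #|V|%:R) - 16 * D g ^+ (2 * j) / #|V|%:R <=
  EX (fun w => #|Layer g U j w|%:R).
Proof.
move=> D2 + + mm; set n : R := #|V|%:R.
have D0 : 0 <= D g by rewrite (le_trans _ D2).
have n0 : 0 < n by rewrite ltr0n; apply/card_gt0P; exists r.
have q0 : 0 <= eprob mu g by exact: eprob_ge0.
elim: j U => [|j IH] U rU Um.
  rewrite muln0 !expr0 !mul0r subr0 !mul1r mulr1.
  rewrite (eq_Ex _ (f' := fun=> 1)) ?(Ex_cst mu_sum).
    by rewrite gerBl divr_ge0 // ltW.
  move=> w; rewrite /layer /= (_ : _ :\: U = [set r]) ?cards1 //.
  by apply/setP => x; rewrite !inE andbC; case: eqP => //= ->; rewrite rU.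
set Lj := _ - _ in IH.
pose S := ~: (r |: U).
have step v : v \in S -> eprob mu g * Lj - eprob mu g ^+ 2 * (8 * D g ^+ (2 * j)) <=
    EX (fun w => (v \in Layer g U j.+1 w)%:R).
  rewrite !inE negb_or => /andP[vr vU].
  apply: le_trans (Ex_le mu_ge0 (fun w => layer_indicator_ge g w j vU vr)).
  rewrite ExB; apply: lerB.
    rewrite Ex_sum (eq_bigr _ (fun x _ => Ex_layer_edge r mu_sum g U j x v)).
    rewrite -mulr_suml mulrC ler_wpM2r // -Ex_sum.
    apply: le_trans (IH (v |: U) _ _) _.
    - by rewrite !inE negb_or eq_sym vr.
    - by rewrite cardsU1 vU; move: Um; lia.
    - by apply: Ex_le => // w; rewrite natr_card.
  apply: le_trans (_ : eprob mu g ^+ 2 * EX (fun w => #|Ball g (v |: U) j w|%:R ^+ 2) <= _).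
    rewrite Ex_sum (eq_Ex _ (fun w => card_sqr R (Ball g (v |: U) j w))).
    rewrite Ex_sum mulr_sumr; apply: ler_sum => x _.
    rewrite !Ex_sum mulr_sumr big_mkcond /=; apply: ler_sum => y _.
    case: ifP => [yx|_]; last first.
      by rewrite mulr_ge0 ?exprn_ge0 ?Ex_ge0 // => w; rewrite mulr_ge0 ?ler0n.
    apply: le_trans (Ex_edge2_le _ _ _ _ _) _; rewrite 1?eq_sym //.
    - move=> i w t vi; rewrite (layer_upd _ _ _ _ _ _ vi) ?(ball_upd _ _ _ _ _ _ vi) //;
        by rewrite !inE eqxx.
    - rewrite mulrC -expr2 ler_wpM2l ?exprn_ge0 //; apply: Ex_le => // w.
      by rewrite ler_wpM2r ?ler0n // ler_bool // => /layer_ball.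
  by rewrite ler_wpM2l ?exprn_ge0 // Ex_card_ball_sqr.
apply: (@le_trans _ _ (\sum_(v in S)
    (eprob mu g * Lj - eprob mu g ^+ 2 * (8 * D g ^+ (2 * j))))); last first.
  rewrite (eq_Ex _ (fun w => natr_card R (Layer g U j.+1 w))) Ex_sum.
  rewrite (bigID (mem S) predT) /= -[leLHS]addr0 lerD ?ler_sum //.
  by apply: sumr_ge0 => v _; apply: Ex_ge0 => // w; exact: ler0n.
rewrite sumr_const -[leRHS]mulr_natl.
have kn : #|S|%:R <= n by rewrite ler_nat max_card.
have knm : n - m%:R <= #|S|%:R.
  rewrite lerBlDr -natrD ler_nat.
  have := cardsC (r |: U); rewrite cardsU1 rU -/S; move: Um; lia.
have jm : 0 <= 1 - j%:R * m%:R / n.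
  rewrite subr_ge0 ler_pdivrMr // mul1r -natrM ler_nat (leq_trans _ mm) //.
  by rewrite leq_mul2r; apply/orP; right; move: Um; lia.
move: (exprn_ge0 j D0) kn knm jm; rewrite /Lj mulnS !exprS -/n.
rewrite mul2n -addnn exprD.
set k := #|S|%:R; set X := D g ^+ j; set q := eprob mu g in q0 D2 *.
rewrite -(natr1 j); set jr := j%:R; set mr := m%:R; move=> X0 kn knm jm.
have mr0 : 0 <= mr by exact: ler0n.
have jr0 : 0 <= jr by exact: ler0n.
have k0 : 0 <= k by exact: ler0n.
set jn := jr * mr / n in jm *.
have -> : (jr + 1) * mr / n = jn + mr / n by rewrite /jn !mulrDl mul1r.
have jn0 : 0 <= jn by rewrite /jn divr_ge0 ?mulr_ge0 // ltW.
set i := n^-1; have i0 : 0 < i by rewrite invr_gt0.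
have ni : n * i = 1 by rewrite /i divff // gt_eqF.
rewrite -/n in D2 *.
clearbody jn i k X q jr mr.
have n0' := ltW n0; have i0' := ltW i0.
have e1 : n * q * X * (1 - (jn + mr * i)) <= k * q * (X * (1 - jn)).
  apply: (@le_trans _ _ ((n - mr) * q * (X * (1 - jn)))); last first.
    by rewrite ler_wpM2r ?mulr_ge0 // ler_wpM2r.
  rewrite -subr_ge0 (_ : _ - _ = q * X * (mr * jn) + q * X * mr * (n * i - 1)).
    by rewrite ni subrr mulr0 addr0 !mulr_ge0.
  by ring.
have e2 : k * q * (16 * (X * X) * i) <= n * q * (16 * (X * X) * i).
  by rewrite ler_wpM2r ?ler_wpM2r // !mulr_ge0 // ltW.
have e3 : k * (q ^+ 2 * (8 * (X * X))) <= n * (q ^+ 2 * (8 * (X * X))).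
  by rewrite ler_wpM2r // !mulr_ge0.
have e4 : n * (q ^+ 2 * (8 * (X * X))) = (n * q) * (n * q) * 8 * (X * X) * i.
  have -> : (n * q) * (n * q) * 8 * (X * X) * i = n * (q ^+ 2 * (8 * (X * X))) * (n * i) by ring.
  by rewrite ni mulr1.
have e5 : n * q * (16 * (X * X) * i) <= (n * q) * (n * q) * 8 * (X * X) * i.
  rewrite -subr_ge0 (_ : _ - _ = (n * q) * (n * q - 2) * (8 * (X * X) * i)).
    by rewrite !mulr_ge0 // subr_ge0.
  by ring.
lra.
Qed.

End MomentBounds.

(** * Growth and expansion of the balls *)

Definition few_nbrs (V : finType) (e : rel V) (M : nat) (A : {set V}) : {set V} :=
  [set v in ~: A | (#|[set x in A | e x v]| < M)%N].

Definition expands (R : realType) (V : finType) (e : rel V) (M : nat) (a b : R) :=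
  [forall A : {set V}, (a <= #|A|%:R) ==> (#|few_nbrs e M A|%:R <= b)].

Section Events.
Variables (R : realType) (V T : finType) (mu : T -> R) (r : V).
Hypothesis mu_ge0 : forall t, 0 <= mu t.
Hypothesis mu_sum : \sum_t mu t = 1.
Local Notation space := {ffun vpair V -> T}.
Implicit Types (w : space) (f : space -> R) (x y u v : V) (U : {set V}) (j l : nat).
Implicit Types g : T -> bool.

Local Notation D g := (#|V|%:R * eprob mu g).
Local Notation Ball g U j w := (ball r (rgraph_adj g w) U j).
Local Notation Layer g U j w := (layer r (rgraph_adj g w) U j).
Local Notation EX := (Ex mu).

(** Chebyshev's inequality centred at [X = D^l] instead of the mean: the second moment is at most
    [X^2 (1 + 1 / (D - 1))] and the mean at least [X (1 - l^2 / n - 16 X / n)]. *)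
Lemma prob_layer_small g l : 2 <= D g -> (l * l <= #|V|)%N ->
  EX (fun w => (#|Layer g set0 l w|%:R < D g ^+ l / 2)%R%:R) <=
  4 * ((D g - 1)^-1 + 2 * (l * l)%:R / #|V|%:R + 32 * D g ^+ l / #|V|%:R).
Proof.
move=> D2 ll; set X := D g ^+ l; set n : R := #|V|%:R.
have D1 : 1 < D g by apply: lt_le_trans D2; rewrite ltr1n.
have X0 : 0 < X by rewrite exprn_gt0 // (lt_trans _ D1).
have n0 : 0 < n by rewrite ltr0n; apply/card_gt0P; exists r.
apply: le_trans (Ex_markov mu_ge0 (a := (X / 2) ^+ 2)
  (f := fun w => (#|Layer g set0 l w|%:R - X) ^+ 2) _ _ _) _.
- by rewrite exprn_gt0 // divr_gt0.
- by move=> w; exact: sqr_ge0.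
- move=> w lt; rewrite -[leRHS]sqrrN opprB ler_sqr ?nnegrE ?divr_ge0 ?(ltW X0) //; last first.
    by move: lt; lra.
  by move: lt; lra.
have := Ex_card_layer_sqr r mu_ge0 mu_sum set0 l (ltW D1).
have := @Ex_card_layer_ge _ _ _ _ r mu_ge0 mu_sum g set0 l l D2.
rewrite inE cards0 => /(_ isT (leqnn _) ll); rewrite exprS mul2n -addnn exprD -/X -/n.
set S1 := EX _; set S2 := EX _ => H1 H2.
have -> : EX (fun w => (#|Layer g set0 l w|%:R - X) ^+ 2) = S2 - 2 * X * S1 + X ^+ 2.
  rewrite /S1 /S2 -ExZ -ExB -[X in _ + X](Ex_cst (I := vpair V) mu_sum) -ExD.
  by apply: eq_Ex => w; ring.
have {}H2 : S2 <= X ^+ 2 * (1 + (D g - 1)^-1).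
  have D1' : 0 < D g - 1 by rewrite subr_gt0.
  rewrite -(ler_pM2l D1'); apply: (le_trans H2).
  have Di : (D g - 1) * (D g - 1)^-1 = 1 by rewrite divff // gt_eqF.
  rewrite [leRHS]mulrCA [in leRHS]mulrDr mulr1 Di; move: X0; clear; nra.
rewrite natrM; set i := (D g - 1)^-1 in H2 *.
set k := l%:R / n in H1 *.
set z := X / n in H1 *.
have {}H1 : X * (1 - l%:R * l%:R / n - 16 * z) <= S1.
  by apply: le_trans H1; rewrite /z le_eqVlt; apply/orP; left; apply/eqP; ring.
rewrite mulrC ler_pdivrMr ?exprn_gt0 ?divr_gt0 //.
have -> : 32 * X / n = 32 * z by rewrite /z mulrA.
have -> : 2 * (l%:R * l%:R) / n = 2 * (l%:R * l%:R / n) by rewrite -mulrA.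
set c := l%:R * l%:R / n in H1 *.
have := ler_pM2l X0; clearbody S1 S2 i z c => /(_ _ _) HX.
have H3 : X * (X * (1 - c - 16 * z)) <= X * S1 by rewrite HX.
clear -H2 H3; lra.
Qed.

Lemma mean_edge g (c : R) : mean mu (fun t => if g t then c else 1) = 1 - eprob mu g * (1 - c).
Proof.
rewrite -[X in _ = X - _]mu_sum /eprob /mean mulr_suml -sumrB; apply: eq_bigr => t _.
by case: (g t); rewrite ?mulr0 ?mulr1 ?mul0r ?subr0 //; ring.
Qed.

Lemma expR_N_ge (x : R) : 1 - x <= expR (- x).
Proof. exact: expR_ge1Dx. Qed.

Lemma eprob_le1 g : eprob mu g <= 1.
Proof.
rewrite -mu_sum; apply: ler_sum => t _.
by rewrite ler_piMr //; case: (g t); rewrite ?ler0n.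
Qed.

(* Summing over the complement [W] of the next ball: the vertices of [W] see
   none of the at least [a] vertices of the current one. *)
Lemma prob_ball_step g l (a b c : R) : 0 <= c ->
  EX (fun w => ((a <= #|Ball g set0 l w|%:R)%R && (#|Ball g set0 l.+1 w|%:R < b)%R)%:R) <=
  expR (c * b) * (expR (- c) + expR (- (eprob mu g * a))) ^+ #|V|.
Proof.
move=> c0; set z := expR (- (_ * a)); set y := expR (- c).
have q0 : 0 <= eprob mu g by exact: eprob_ge0.
pose P W w := (a <= #|Ball g set0 l w|%:R) && (Ball g set0 l.+1 w == ~: W).
(* On this event the deletion of [W] does not change the ball [A] of radius [l], and [A] computed
   without [W] is independent of the edges at [W]. All pairs between [A] and [W] must be absent,
   which has probability [(1 - q)^(|A| |W|)]. *)
have PW W : EX (fun w => (P W w)%:R) <= z ^+ #|W|.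
  pose h (b : bool) : R := if b then 0 else 1.
  pose F (A : {set V}) w : R := (Ball g W l w == A)%:R *
    \prod_(x in A) \prod_(v in W) h (rgraph_adj g w x v).
  apply: (@le_trans _ _ (EX (fun w => \sum_(A : {set V} | [disjoint A & W] && (a <= #|A|%:R)) F A w))).
    have F0 A w : 0 <= F A w.
      rewrite mulr_ge0 ?ler0n // prodr_ge0 // => x _; rewrite prodr_ge0 // => v _.
      by rewrite /h; case: ifP.
    apply: Ex_le => // w; case: (boolP (P W w)) => /= [|_]; last exact: sumr_ge0.
    case/andP => aB /eqP BW; have dW : [disjoint W & Ball g set0 l w].
      rewrite disjoint_sym disjoint_subset; apply/subsetP => x xB.
      by have := subsetP (ballS r (rgraph_adj g w) set0 l) x xB; rewrite BW inE.
    rewrite (bigD1 (Ball g set0 l w)) /=; last by rewrite disjoint_sym dW.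
    apply: ler_wpDr; first exact: sumr_ge0.
    rewrite /F -[X in Ball g X l w]setU0 ball_remove // eqxx mul1r.
    rewrite big1 // => x xB; rewrite big1 // => v vW; rewrite /h.
    case: ifP => // exv; have : v \in Ball g set0 l.+1 w.
      by rewrite in_ballS inE /=; apply/orP; right; apply/existsP; exists x; rewrite xB.
    by rewrite BW inE vW.
  rewrite Ex_sum; apply: (@le_trans _ _
      (\sum_(A : {set V}) EX (fun w => (Ball g W l w == A)%:R) * z ^+ #|W|)).
    rewrite big_mkcond /=; apply: ler_sum => A _; case: ifP => [/andP[dA aA]|_]; last first.
      by rewrite mulr_ge0 ?exprn_ge0 ?expR_ge0 ?Ex_ge0 // => w; exact: ler0n.
    rewrite (Ex_edges mu_sum) //; last first.
      by move=> v vW i w t vi; rewrite (ball_upd _ _ _ _ _ vW vi).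
    rewrite ler_wpM2l ?Ex_ge0 //.
    rewrite /h (mean_edge g 0) subr0 mulr1 exprM lerXn2r ?nnegrE ?expR_ge0 //.
      by rewrite exprn_ge0 // subr_ge0 eprob_le1.
    apply: (@le_trans _ _ (expR (- eprob mu g) ^+ #|A|)).
      by rewrite lerXn2r ?nnegrE ?expR_ge0 ?subr_ge0 ?eprob_le1 ?expR_N_ge.
    by rewrite -expRM_natl ler_expR mulrN lerN2 mulrC ler_wpM2r.
  rewrite -mulr_suml ler_piMl ?exprn_ge0 ?expR_ge0 // -Ex_sum.
  rewrite -[leRHS](Ex_cst (I := vpair V) mu_sum); apply: Ex_le => // w.
  rewrite (bigD1 (Ball g W l w)) //= eqxx big1 ?addr0 // => A.
  by rewrite eq_sym => /negPf ->.
(* Exponential Markov inequality: the weight [expR (c * b) * y ^+ #|~: W|] is at least 1 when the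
   ball [~: W] has fewer than [b] vertices. The sum over all [W] then expands the power of
   [z + y]. *)
apply: (@le_trans _ _ (EX (fun w => \sum_(W : {set V}) (expR (c * b) * y ^+ #|~: W|) * (P W w)%:R))).
  have G0 W w : 0 <= expR (c * b) * y ^+ #|~: W| * (P W w)%:R.
    by rewrite !mulr_ge0 ?exprn_ge0 ?expR_ge0 ?ler0n.
  apply: Ex_le => // w; case: (boolP (_ && _)) => /= [/andP[aB Bb]|_]; last exact: sumr_ge0.
  apply: le_trans (ler_sum_term (~: Ball g set0 l.+1 w) _) => //.
  rewrite /P setCK eqxx aB mulr1 -expRM_natl -expRD mulrN -mulrN1.
  rewrite -[leLHS]expR0 ler_expR; move: Bb c0.
  by set k := #|_|%:R => kb c0; rewrite mulrN1 subr_ge0 mulrC ler_wpM2l // ltW.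
rewrite Ex_sum -[X in (_ + _) ^+ X]cardsT -prodr_const /=.
have -> : \prod_(i in [set: V]) (y + z) = \prod_(i : V) (z + y).
  by rewrite big_mkcond /=; apply: eq_bigr => i _; rewrite inE addrC.
rewrite bigA_distr mulr_sumr; apply: ler_sum => W _; rewrite ExZ -mulrA.
rewrite ler_wpM2l ?expR_ge0 // (bigID (mem W)) /=.
rewrite (eq_bigr (fun=> z)); last by move=> i ->.
rewrite [X in _ <= _ * X](eq_bigr (fun=> y)); last by move=> i /negPf ->.
rewrite !prodr_const mulrC; apply: ler_pM; rewrite ?exprn_ge0 ?expR_ge0 ?Ex_ge0 //.
rewrite le_eqVlt; apply/orP; left; apply/eqP; congr (_ ^+ _).
by apply: eq_card => i; rewrite !inE.
Qed.

(** Union bound over at most [4^n <= e^(2 n)] pairs of sets. For one pair, the weight [2^(M |B|)]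
    times [1/2] for each edge between [A] and [B] is at least 1 when every vertex of [B] has fewer
    than [M] neighbours in [A], and its mean is at most [exp (M |B| - q |A| |B| / 2)]. *)
Lemma prob_not_expands g (M : nat) (a b : R) : M%:R <= eprob mu g * a / 2 ->
  EX (fun w => (~~ expands (rgraph_adj g w) M a b)%:R) <=
  expR (2 * #|V|%:R - b * (eprob mu g * a / 2 - M%:R)).
Proof.
move=> Mqa; set q := eprob mu g in Mqa *.
have q0 : 0 <= q by exact: eprob_ge0.
have q1 : q <= 1 by exact: eprob_le1.
have exp2 : (2 : R) <= expR 1 by rewrite (le_trans _ (expR_ge1Dx 1)).
pose h (b : bool) : R := if b then 2^-1 else 1.
pose F (A B : {set V}) w : R := 2 ^+ (M * #|B|) *
    \prod_(x in A) \prod_(v in B) h (rgraph_adj g w x v).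
have h0 c : 0 <= h c by rewrite /h; case: ifP; rewrite ?invr_ge0.
have F0 A B w : 0 <= F A B w.
  rewrite mulr_ge0 ?exprn_ge0 // prodr_ge0 // => x _; exact: prodr_ge0.
pose Q (A B : {set V}) := [&& [disjoint A & B], a <= #|A|%:R & b < #|B|%:R].
apply: (@le_trans _ _ (EX (fun w => \sum_(A : {set V}) \sum_(B : {set V} | Q A B) F A B w))).
  apply: Ex_le => // w; case: (boolP (expands _ _ _ _)) => /= [_|].
    by apply: sumr_ge0 => A _; exact: sumr_ge0.
  case/forallPn => A; rewrite negb_imply -ltNge => /andP[aA bB].
  apply: le_trans (ler_sum_term A _); last by move=> ?; exact: sumr_ge0.
  set B := few_nbrs _ _ _ in bB; rewrite (bigD1 B) /=; last first.
    rewrite /Q aA bB !andbT disjoint_sym disjoint_subset; apply/subsetP => v.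
    by rewrite !inE => /andP[].
  apply: ler_wpDr; first exact: sumr_ge0.
  rewrite /F exchange_big /= exprM -prodr_const -big_split /=.
  apply: (@le_trans _ _ (\prod_(v in B) 1)); first by rewrite big1_eq.
  apply: ler_prod => v.
  rewrite !inE ler01 /= => /andP[_ degv].
  rewrite (bigID (fun x => rgraph_adj g w x v)) /= [X in _ * (_ * X)]big1; last first.
    by move=> x /andP[_ /negPf]; rewrite /h => ->.
  rewrite mulr1 (eq_bigr (fun=> 2^-1)); last by move=> x /andP[_]; rewrite /h => ->.
  rewrite prodr_const exprVn mulrC ler_pdivlMl ?exprn_gt0 // mulr1.
  rewrite ler_weXn2l ?ler1n // ltnW // (leq_ltn_trans _ degv) //.
  by rewrite subset_leq_card //; apply/subsetP => x; rewrite !inE.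
have FE A B : Q A B -> EX (F A B) <= expR (- (b * (q * a / 2 - M%:R))).
  case/and3P => dAB aA bB; rewrite /F ExZ.
  rewrite (eq_Ex _ (f' := fun w => 1 *
    \prod_(x in A) \prod_(v in B) h (rgraph_adj g w x v))); last by move=> w; rewrite mul1r.
  rewrite (Ex_edges mu_sum) // (Ex_cst mu_sum) mul1r /h (mean_edge g) -/q.
  apply: (@le_trans _ _ (expR 1 ^+ (M * #|B|) * expR (- (q / 2)) ^+ (#|A| * #|B|))).
    apply: ler_pM; rewrite ?exprn_ge0 //; first by move: q1 q0; lra.
      by rewrite lerXn2r ?nnegrE ?expR_ge0.
    rewrite lerXn2r ?nnegrE ?expR_ge0 //; first by move: q1 q0; lra.
    by apply: le_trans (expR_N_ge _); move: q0; lra.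
  rewrite -!expRM_natl -expRD ler_expR !natrM.
  have : b * (q * a / 2 - M%:R) <= #|B|%:R * (q * a / 2 - M%:R).
    by rewrite ler_wpM2r ?subr_ge0 // ltW.
  have : #|B|%:R * (q * a) <= #|B|%:R * (q * #|A|%:R) by rewrite !ler_wpM2l.
  by set k := #|B|%:R; lra.
rewrite Ex_sum expRD.
apply: (@le_trans _ _ (\sum_(A : {set V}) \sum_(B : {set V})
    expR (- (b * (q * a / 2 - M%:R))))).
  apply: ler_sum => A _; rewrite Ex_sum big_mkcond /=; apply: ler_sum => B _.
  by case: ifP => [/FE //|_]; exact: expR_ge0.
rewrite !sumr_const -[leLHS]mulr_natl -[X in _ * X <= _]mulr_natl mulrA.
rewrite ler_wpM2r ?expR_ge0 // -natrM.
have -> : #|{: {set V}}| = (2 ^ #|V|)%N by rewrite -[LHS]cardsT -powersetT card_powerset cardsT.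
rewrite -natrM -expnD addnn -mul2n natrX -[X in expR X]mulr1 expRM_natl.
by rewrite lerXn2r ?nnegrE ?expR_ge0.
Qed.

End Events.

(** * Vertices with few parents in an expanding graph *)

Section Thickness.
Variables (R : realType) (V : finType) (r : V) (e : rel V) (M : nat) (a b : R).
Hypothesis M_gt0 : (0 < M)%N.
Local Notation Ball j := (ball r e set0 j).
Local Notation Layer j := (layer r e set0 j).

Lemma few_nbrs_ball j v : v \notin Ball j.+1 -> v \in few_nbrs e M (Ball j).
Proof.
rewrite in_ballS inE /= negb_or => /andP[vB nv]; rewrite !inE vB /=.
rewrite (_ : [set x in _ | _] = set0) ?cards0 //; apply/setP => x; rewrite !inE.
by apply: contraNF nv => /andP[xB exv]; apply/existsP; exists x; rewrite xB.
Qed.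

Hypothesis exp_e : expands e M (a / 2) b.

Lemma expandsP (A : {set V}) : a / 2 <= #|A|%:R -> #|few_nbrs e M A|%:R <= b.
Proof. by move: exp_e => /forallP /(_ A) /implyP. Qed.

Lemma ball_near_full j : 0 <= a -> a <= #|Ball j|%:R ->
  #|V|%:R - b <= #|Ball j.+1|%:R.
Proof.
move=> a0 aB; have : #|few_nbrs e M (Ball j)|%:R <= b by apply: expandsP; lra.
have : (#|~: Ball j.+1| <= #|few_nbrs e M (Ball j)|)%N.
  apply: subset_leq_card; apply/subsetP => v; rewrite inE; exact: few_nbrs_ball.
rewrite -(ler_nat R); move: (cardsC (Ball j.+1)) => <-; rewrite natrD.
by set x := #|Ball _|%:R; lra.
Qed.

Lemma few_thin_vertices l : 0 < a -> a <= #|Ball l.+1|%:R ->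
  exists K : {set V}, #|K|%:R <= 2 * b /\
    forall j v, v \in Layer j.+1 -> v \notin K -> (l < j)%N ->
      (M <= #|[set x in Layer j | e x v]|)%N.
Proof.
move=> a0 al; have exJ : exists J, (a <= #|Ball J|%:R) by exists l.+1.
case: (ex_minnP exJ) => J aJ minJ; have Jl := minJ _ al.
have key : exists K1 : {set V}, #|K1|%:R <= b /\
    forall v, v \in Layer J.+1 -> v \notin K1 ->
      (M <= #|[set x in Layer J | e x v]|)%N.
  have [thick|thin] := leP (a / 2) (#|Layer J|%:R).
    exists (few_nbrs e M (Layer J)); split; first exact: expandsP.
    move=> v vL; rewrite !inE negb_and negbK -leqNgt => /orP[/layer_ball|//].
    by rewrite (negPf (layerS_notin vL)).
  case: J => [|J] in aJ minJ Jl thin *.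
    by move: thin aJ; rewrite /layer /=; set x := #|_|%:R; lra.
  exists (few_nbrs e M (Ball J)); split.
    apply: expandsP; move: aJ thin; rewrite ball_layerU.
    have := (leq_card_setU (Ball J) (Layer J.+1)).1; rewrite -(ler_nat R) natrD.
    by set x := #|_ :|: _|%:R; lra.
  by move=> v /layerS_notin /few_nbrs_ball ->.
case: key => K1 [K1b K1P]; exists (few_nbrs e M (Ball J) :|: K1); split.
  have := (leq_card_setU (few_nbrs e M (Ball J)) K1).1; rewrite -(ler_nat R) natrD.
  have : #|few_nbrs e M (Ball J)|%:R <= b by apply: expandsP; lra.
  by move: K1b; lra.
move=> j v vj; rewrite inE negb_or => /andP[vJ vK1] lj.
have [Jj|jJ|Jj] := ltngtP J j; last by rewrite Jj in K1P; exact: K1P.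
- case/negP: vJ; apply: few_nbrs_ball; apply: contra (layerS_notin vj).
  exact: (subsetP (ball_le _ _ _ Jj)).
- by move: (leq_trans lj (ltnW jJ)) Jl; lia.
Qed.

End Thickness.

(** * The intersection of the balls of the two graphs *)

Section Joint.
Variables (R : realType) (V T : finType) (mu : T -> R) (r : V).
Hypothesis mu_ge0 : forall t, 0 <= mu t.
Hypothesis mu_sum : \sum_t mu t = 1.
Variables (g1 g2 : T -> bool) (q rho1 : R).
Hypothesis q1 : eprob mu g1 = q.
Hypothesis q2 : eprob mu g2 = q.
Hypothesis q12 : eprob mu (fun t => g1 t && g2 t) <= rho1 * q.
Hypothesis rho1_le1 : rho1 <= 1.
Local Notation space := {ffun vpair V -> T}.
Implicit Types (w : space) (f : space -> R) (x y u v : V) (U : {set V}) (j l : nat).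

Local Notation n := (#|V|%:R).
Local Notation D := (n * q).
Local Notation Ball g U j w := (ball r (rgraph_adj g w) U j).
Local Notation EX := (Ex mu).

Hypothesis rhoD : 2 <= rho1 * D.

Let q0 : 0 <= q.
Proof. by rewrite -q1 eprob_ge0. Qed.

Let D2 : 2 <= D.
Proof. by apply: (le_trans rhoD); rewrite ler_piMl // mulr_ge0. Qed.

(** The term [- 1] absorbs the root in the recursion: with [Y = (rho1 * D)^j], one has [1 + rho1 * D
    * (2 * Y - 1) <= 2 * rho1 * D * Y - 1] because [2 <= rho1 * D]. *)
Definition joint_bound j : R := 2 * (rho1 * D) ^+ j - 1 + 16 * D ^+ (2 * j) / n.

Lemma Ex_common_edge u x f : avoids u f -> (forall w, 0 <= f w) ->
  EX (fun w => f w * (rgraph_adj g1 w x u && rgraph_adj g2 w x u)%:R) <=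
  EX f * (rho1 * q).
Proof.
move=> fu f0; rewrite (eq_Ex _ (fun w => congr1 (fun b : bool => f w * b%:R)
   (rgraph_adjI g1 g2 w x u))).
have [->|xu] := eqVneq x u.
  rewrite (eq_Ex _ (f' := fun=> 0)) ?(Ex_cst mu_sum); last first.
    by move=> w; rewrite rgraph_adj_irr mulr0.
  rewrite mulr_ge0 ?Ex_ge0 //; apply: le_trans q12; exact: eprob_ge0.
by rewrite (Ex_edge mu_sum) // ler_wpM2l ?Ex_ge0.
Qed.

(** The predecessors of [u] in the two graphs without [u] either coincide ([F1], one common edge) or
    differ ([F2], two independent edges). The balls [B1] and [B2] are dependent, so the mean of
    [|B1| |B2|] is bounded through [(|B1|^2 + |B2|^2) / 2]. *)
Lemma Ex_card_ballI U j :
  EX (fun w => #|Ball g1 U j w :&: Ball g2 U j w|%:R) <= joint_bound j.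
Proof.
have n0 : 0 < n :> R by rewrite ltr0n; apply/card_gt0P; exists r.
elim: j U => [|j IH] U.
  apply: (@le_trans _ _ 1); last first.
    rewrite /joint_bound muln0 !expr0.
    have : 0 <= 16 * 1 / n :> R by rewrite divr_ge0 ?(ltW n0) // mulr1.
    by lra.
  rewrite -[leRHS](Ex_cst (I := vpair V) mu_sum); apply: Ex_le => // w.
  rewrite lern1 -(cards1 r); apply: subset_leq_card; apply/subsetP => v.
  by rewrite !inE => /andP[/andP[_ ->]].
pose B1 u w := Ball g1 (u |: U) j w; pose B2 u w := Ball g2 (u |: U) j w.
pose F1 u w : R := \sum_x (x \in B1 u w :&: B2 u w)%:R *
  (rgraph_adj g1 w x u && rgraph_adj g2 w x u)%:R.
pose F2 u w : R := \sum_x \sum_(y | y != x) ((x \in B1 u w)%:R * (y \in B2 u w)%:R) *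
  ((rgraph_adj g1 w x u)%:R * (rgraph_adj g2 w y u)%:R).
have F10 u w : 0 <= F1 u w by apply: sumr_ge0 => x _; rewrite mulr_ge0.
have F20 u w : 0 <= F2 u w.
  by apply: sumr_ge0 => x _; apply: sumr_ge0 => y _; rewrite !mulr_ge0.
have pw w : #|Ball g1 U j.+1 w :&: Ball g2 U j.+1 w|%:R <=
    1 + \sum_u (F1 u w + F2 u w).
  rewrite natr_card (bigD1 r) //= lerD ?lern1 ?leq_b1 //.
  rewrite [leRHS](bigD1 r) //=; apply: ler_wpDl; first by rewrite addr_ge0.
  apply: ler_sum => u ur; case: (boolP (u \in _)) => /= [|_]; last by rewrite addr_ge0.
  rewrite inE => /andP[/ball_pred /(_ ur)[x xB e1] /ball_pred /(_ ur)[y yB e2]].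
  have [xy|xy] := eqVneq x y.
    apply: ler_wpDr => //; rewrite /F1.
    apply: le_trans (ler_sum_term x _); last by move=> z; rewrite mulr_ge0.
    by rewrite inE /B1 /B2 xB e1 xy yB e2 mulr1.
  apply: ler_wpDl => //; rewrite /F2.
  apply: le_trans (ler_sum_term x _); last first.
    by move=> z; apply: sumr_ge0 => ? _; rewrite !mulr_ge0.
  rewrite (bigD1 y) 1?eq_sym //=; apply: ler_wpDr.
    by apply: sumr_ge0 => ? _; rewrite !mulr_ge0.
  by rewrite /B1 /B2 xB yB e1 e2 !mulr1.
apply: le_trans (Ex_le mu_ge0 pw) _; rewrite ExD (Ex_cst mu_sum) Ex_sum.
have E1 u : EX (F1 u) <= rho1 * q * joint_bound j.
  rewrite Ex_sum; apply: (@le_trans _ _ (\sum_x EX (fun w => (x \in B1 u w :&: B2 u w)%:R) * (rho1 * q))).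
    apply: ler_sum => x _; apply: Ex_common_edge => // i w t ui.
    by rewrite /B1 /B2 !(ball_upd _ _ _ _ _ _ ui) // !inE eqxx.
  rewrite -mulr_suml mulrC ler_wpM2l ?(le_trans _ q12) ?eprob_ge0 //.
  rewrite -Ex_sum; apply: le_trans (IH (u |: U)); apply: Ex_le => // w.
  by rewrite natr_card.
have E2 u : EX (F2 u) <= q ^+ 2 * (8 * D ^+ (2 * j)).
  apply: (@le_trans _ _ (q ^+ 2 * EX (fun w => #|B1 u w|%:R * #|B2 u w|%:R))).
    rewrite [in leRHS](eq_Ex _ (f' := fun w => \sum_x \sum_y (x \in B1 u w)%:R * (y \in B2 u w)%:R)).
      rewrite !Ex_sum mulr_sumr; apply: ler_sum => x _.
      rewrite !Ex_sum mulr_sumr big_mkcond /=; apply: ler_sum => y _.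
      case: ifP => [yx|_]; last by rewrite mulr_ge0 ?exprn_ge0 ?Ex_ge0 // => w; rewrite mulr_ge0.
      apply: le_trans (Ex_edge2_le mu_ge0 mu_sum _ _ _ _ _) _; rewrite 1?eq_sym //.
      - by move=> i w t ui; rewrite /B1 /B2 !(ball_upd _ _ _ _ _ _ ui) // !inE eqxx.
      - by rewrite q1 q2 mulrC expr2.
    move=> w; rewrite !natr_card mulr_suml; apply: eq_bigr => x _.
    by rewrite mulr_sumr.
  rewrite ler_wpM2l ?exprn_ge0 //.
  apply: (@le_trans _ _ (EX (fun w => 2^-1 * #|B1 u w|%:R ^+ 2 + 2^-1 * #|B2 u w|%:R ^+ 2))).
    apply: Ex_le => // w; have := sqr_ge0 (#|B1 u w|%:R - #|B2 u w|%:R : R).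
    by set x := #|B1 u w|%:R; set y := #|B2 u w|%:R; nra.
  rewrite ExD !ExZ.
  have := Ex_card_ball_sqr r mu_ge0 mu_sum (g := g1) (u |: U) j.
  have := Ex_card_ball_sqr r mu_ge0 mu_sum (g := g2) (u |: U) j.
  rewrite q1 q2 => /(_ D2) h2 /(_ D2) h1; rewrite /B1 /B2.
  by move: h1 h2; set x := EX _; set y := EX _; lra.
apply: (@le_trans _ _ (1 + \sum_(u : V)
    (rho1 * q * joint_bound j + q ^+ 2 * (8 * D ^+ (2 * j))))).
  by rewrite lerD2l; apply: ler_sum => u _; rewrite ExD lerD.
rewrite sumr_const -[X in _ + X <= _]mulr_natl /joint_bound mulnS !exprS.
set X := D ^+ (2 * j); set Y := (rho1 * D) ^+ j.
have X0 : 0 <= X by rewrite exprn_ge0 // (le_trans _ D2).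
set i := n^-1; have i0 : 0 <= i by rewrite invr_ge0 ltW.
have ni : n * i = 1 by rewrite /i divff // gt_eqF.
have e1 : n * (q ^+ 2 * (8 * X)) = 8 * (D * (D * X)) * i.
  have -> : 8 * (D * (D * X)) * i = n * (q ^+ 2 * (8 * X)) * (n * i) by ring.
  by rewrite ni mulr1.
have e2 : rho1 * D * (16 * X * i) <= 8 * (D * (D * X)) * i.
  apply: (@le_trans _ _ (1 * D * (16 * X * i))).
    rewrite ler_wpM2r ?mulr_ge0 // ler_wpM2r // (le_trans _ D2) //.
  rewrite -subr_ge0 (_ : _ - _ = 8 * D * X * i * (D - 2)); last by ring.
  by rewrite !mulr_ge0 ?subr_ge0 // (le_trans _ D2).
clearbody X Y i; move: e1 e2 rhoD; lra.
Qed.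

(** Counts the common edges that can carry a common parent within distance [l]; deleting [v] makes
    both balls independent of the edges at [v]. *)
Lemma Ex_common_children l :
  EX (fun w => \sum_v \sum_u (u \in Ball g1 [set v] l w :&: Ball g2 [set v] l w)%:R *
    (rgraph_adj g1 w u v && rgraph_adj g2 w u v)%:R) <=
  rho1 * D * joint_bound l.
Proof.
rewrite Ex_sum; apply: (@le_trans _ _ (\sum_(v : V) rho1 * q * joint_bound l)); last first.
  by rewrite sumr_const -[leLHS]mulr_natl !mulrA (mulrC rho1).
apply: ler_sum => v _; rewrite Ex_sum.
apply: (@le_trans _ _ (\sum_u EX (fun w =>
   (u \in Ball g1 [set v] l w :&: Ball g2 [set v] l w)%:R) * (rho1 * q))).
  apply: ler_sum => u _; apply: Ex_common_edge => // i w t vi.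
  by rewrite !(ball_upd _ _ _ _ _ _ vi) // !inE eqxx.
rewrite -mulr_suml mulrC ler_wpM2l ?(le_trans _ q12) ?eprob_ge0 //.
rewrite -Ex_sum; apply: le_trans (Ex_card_ballI [set v] l); apply: Ex_le => // w.
by rewrite natr_card.
Qed.

End Joint.

(** * Overlap of the trees *)

Lemma sum_unif_pmf_le1 (R : realType) (A : finType) (S : {set A}) :
  \sum_a unif_pmf R S a <= 1.
Proof.
rewrite -mulr_suml -natr_card; have [->|s0] := posnP #|S|; first by rewrite mul0r.
by rewrite divff // pnatr_eq0 -lt0n.
Qed.

Section Overlap.
Variables (R : realType) (V : finType) (r : V).
Implicit Types (E T : {set {set V}}) (u v x y : V).

Lemma card_inv_le1 (A : {set V}) : (#|A|%:R^-1 : R) <= 1.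
Proof.
have [->|A0] := posnP #|A|; first by rewrite invr0.
by rewrite invf_le1 ?ler1n ?ltr0n.
Qed.

Lemma overlap_markov (T1 T2 : {set {set V}}) (eps : R) : 0 < eps ->
  #|V|%:R / 4 <= #|T1|%:R :> R -> #|V|%:R / 4 <= #|T2|%:R :> R ->
  (eps < overlap R r T1 T2)%R%:R <=
  4 / (eps * #|V|%:R) * #|directed_edges r T1 :&: directed_edges r T2|%:R :> R.
Proof.
move=> eps0 c1 c2; set d := #|_ :&: _|; set n : R := #|V|%:R.
have n0 : 0 < n by rewrite ltr0n; apply/card_gt0P; exists r.
case: (ltrP eps _) => [lt|_]; last by rewrite mulr_ge0 ?divr_ge0 ?mulr_ge0 // ltW.
have s0 : n / 4 <= Num.sqrt (#|T1|%:R * #|T2|%:R).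
  have n4 : 0 <= n / 4 by rewrite divr_ge0 // ltW.
  rewrite -(ger0_norm n4) -sqrtr_sqr ler_wsqrtr // expr2.
  by apply: ler_pM.
have s00 : 0 < Num.sqrt (#|T1|%:R * #|T2|%:R) :> R by apply: lt_le_trans s0; rewrite divr_gt0.
move: lt; rewrite /overlap -/d ltr_pdivlMr // => lt.
have : eps * (n / 4) <= d%:R by apply: ltW; apply: le_lt_trans lt; rewrite ler_wpM2l // ltW.
rewrite mulr1n mulrAC ler_pdivlMr ?mulr_gt0 // mul1r; lra.
Qed.

Variables (E1 E2 : {set {set V}}).
Hypothesis E1_pair : forall e, e \in E1 -> #|e| = 2%N.
Hypothesis E2_pair : forall e, e \in E2 -> #|e| = 2%N.

Local Notation par1 v := (parents r E1 v).
Local Notation par2 v := (parents r E2 v).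

(** The two trees are drawn independently given the graphs, so the probability that [(u, v)] lies in
    both factorises, and [parent_prob] bounds each factor. *)
Lemma expected_common_edges :
  \sum_T1 \sum_T2 unif_pmf R (comp_spts E1 r) T1 * unif_pmf R (comp_spts E2 r) T2 *
    #|directed_edges r T1 :&: directed_edges r T2|%:R <=
  \sum_v #|par1 v :&: par2 v|%:R / (#|par1 v|%:R * #|par2 v|%:R).
Proof.
set f1 := unif_pmf R _; set f2 := unif_pmf R _.
have f10 T : 0 <= f1 T by rewrite /f1 /unif_pmf divr_ge0.
have f20 T : 0 <= f2 T by rewrite /f2 /unif_pmf divr_ge0.
pose d T (e : V * V) : R := (e \in directed_edges r T)%:R.
have -> : \sum_T1 \sum_T2 f1 T1 * f2 T2 *
    #|directed_edges r T1 :&: directed_edges r T2|%:R =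
    \sum_e (\sum_T f1 T * d T e) * (\sum_T f2 T * d T e).
  transitivity (\sum_T1 \sum_T2 \sum_e (f1 T1 * d T1 e) * (f2 T2 * d T2 e)).
    apply: eq_bigr => T1 _; apply: eq_bigr => T2 _.
    rewrite natr_card mulr_sumr; apply: eq_bigr => e _.
    by rewrite inE -mulnb natrM mulrACA.
  under eq_bigr do rewrite exchange_big /=.
  rewrite exchange_big /=; apply: eq_bigr => e _.
  by rewrite mulr_suml; apply: eq_bigr => T1 _; rewrite mulr_sumr.
pose G u v := (\sum_T f1 T * d T (u, v)) * (\sum_T f2 T * d T (u, v)).
rewrite (eq_bigr (fun e => G e.1 e.2)); last by case.
rewrite -(pair_bigA _ G) /=.
rewrite exchange_big /=; apply: ler_sum => v _.
rewrite natr_card mulr_suml; apply: ler_sum => u _.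
have -> : (u \in par1 v :&: par2 v)%:R / (#|par1 v|%:R * #|par2 v|%:R) =
  ((u \in par1 v)%:R / #|par1 v|%:R) * ((u \in par2 v)%:R / #|par2 v|%:R) :> R.
  by rewrite inE -mulnb natrM invfM mulrACA.
apply: ler_pM; rewrite ?parent_prob //; apply: sumr_ge0 => T _; rewrite mulr_ge0 //.
Qed.

(** The intersection is contained in each parent set, so either factor of the denominator can be
    cancelled; the one left is the set with at least [m] elements. *)
Lemma common_parent_ratio v (m : nat) : (0 < m)%N -> (m <= #|par1 v|)%N || (m <= #|par2 v|)%N ->
  #|par1 v :&: par2 v|%:R / (#|par1 v|%:R * #|par2 v|%:R) <= m%:R^-1 :> R.
Proof.
move=> m0 mp; rewrite invfM.
have a1 := card_inv_le1 (par1 v); have a2 := card_inv_le1 (par2 v).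
have k1 : #|par1 v :&: par2 v|%:R <= #|par1 v|%:R :> R by rewrite ler_nat subset_leq_card // subsetIl.
have k2 : #|par1 v :&: par2 v|%:R <= #|par2 v|%:R :> R by rewrite ler_nat subset_leq_card // subsetIr.
have cancel (A : {set V}) : #|A|%:R * #|A|%:R^-1 <= 1 :> R.
  have [->|A0] := posnP #|A|; first by rewrite mul0r.
  by rewrite divff // pnatr_eq0 -lt0n.
case/orP: mp => mp.
  rewrite mulrCA mulrC; apply: (@le_trans _ _ (1 * #|par1 v|%:R^-1)).
    rewrite ler_wpM2r ?invr_ge0 //; apply: le_trans (cancel (par2 v)).
    by rewrite ler_wpM2r ?invr_ge0.
  by rewrite mul1r lef_pV2 ?posrE ?ltr0n ?ler_nat // (leq_trans m0).
rewrite mulrA; apply: (@le_trans _ _ (1 * #|par2 v|%:R^-1)).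
  rewrite ler_wpM2r ?invr_ge0 //; apply: le_trans (cancel (par1 v)).
  by rewrite ler_wpM2r ?invr_ge0.
by rewrite mul1r lef_pV2 ?posrE ?ltr0n ?ler_nat // (leq_trans m0).
Qed.

Lemma common_parent_ratio_le v :
  #|par1 v :&: par2 v|%:R / (#|par1 v|%:R * #|par2 v|%:R) <=
  #|par1 v :&: par2 v|%:R :> R.
Proof.
by rewrite invfM ler_piMr //; apply: mulr_ile1; rewrite ?invr_ge0 // card_inv_le1.
Qed.

Lemma parent_ball E u v j l : u \in layer r (adj E) set0 j -> v \in layer r (adj E) set0 j.+1 ->
  (j <= l)%N -> u \in ball r (adj E) [set v] l.
Proof.
move=> uj vj jl; apply: (subsetP (ball_le _ _ _ jl)); rewrite -[X in ball _ _ X]setU0.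
by rewrite ball_remove ?layer_ball // disjoints1 layerS_notin.
Qed.

Variables (M l : nat) (a b : R).
Hypothesis M_gt0 : (0 < M)%N.
Hypothesis a_gt0 : 0 < a.
(** The event from which tree sizes and parent counts follow deterministically. Expansion is
    required from [a / 2] because [few_thin_vertices] splits a ball of size [a] into a layer and a
    smaller ball. *)
Definition thick E := expands (adj E) M (a / 2) b && (a <= #|ball r (adj E) set0 l.+1|%:R).

(** The ball of radius [l + 2] misses at most [b <= n / 4] vertices, so the tree has at least
    [3 n / 4 - 1] edges, and [n >= 2]. *)
Lemma thick_spt_size E T : (forall e, e \in E -> #|e| = 2%N) -> thick E ->
  b <= #|V|%:R / 4 -> (2 <= #|V|)%N -> T \in comp_spts E r -> #|V|%:R / 4 <= #|T|%:R :> R.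
Proof.
move=> E2' /andP[ex al] bV V2 /(card_comp_spt E2') CT.
have := ball_near_full M_gt0 ex (ltW a_gt0) al.
have : (#|ball r (adj E) set0 l.+2| <= #|comp_vertices E r|)%N.
  apply: subset_leq_card; apply/subsetP => v /ball_layer[j _ vj]; exact: layer_comp vj.
have : (#|comp_vertices E r| <= #|T| + 1)%N by move: CT; lia.
rewrite -!(ler_nat R) natrD => h1 h2 h3; have V2' : 2 <= #|V|%:R :> R by rewrite ler_nat.
by move: h1 h2 h3 bV V2'; lra.
Qed.

(** A vertex is exceptional in one of the graphs (at most [4 b] such, each contributing at most 1),
    or lies beyond level [l + 1] in one of them and contributes at most [1 / M], or is within level
    [l + 1] in both; then its common parents lie in both balls of radius [l] and the double sum
    counts them. *)
Lemma common_parents_bound : thick E1 -> thick E2 ->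
  \sum_v #|par1 v :&: par2 v|%:R / (#|par1 v|%:R * #|par2 v|%:R) <=
  4 * b + #|V|%:R / M%:R + \sum_v \sum_u
    (u \in ball r (adj E1) [set v] l :&: ball r (adj E2) [set v] l)%:R *
    (adj E1 u v && adj E2 u v)%:R.
Proof.
case/andP => ex1 al1 /andP[ex2 al2].
have [K1 [K1b K1P]] := few_thin_vertices M_gt0 ex1 a_gt0 al1.
have [K2 [K2b K2P]] := few_thin_vertices M_gt0 ex2 a_gt0 al2.
pose Y v : R := \sum_u
    (u \in ball r (adj E1) [set v] l :&: ball r (adj E2) [set v] l)%:R *
    (adj E1 u v && adj E2 u v)%:R.
have Y0 v : 0 <= Y v by apply: sumr_ge0 => u _; rewrite mulr_ge0.
have Mi0 : 0 <= M%:R^-1 :> R by rewrite invr_ge0.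
apply: (@le_trans _ _ (\sum_v ((v \in K1)%:R + (v \in K2)%:R + M%:R^-1 + Y v))); last first.
  rewrite !big_split /= -!natr_card sumr_const -[X in _ + X + _ <= _]mulr_natl.
  by rewrite lerD2r lerD2r; move: K1b K2b; lra.
apply: ler_sum => v _.
have [i0|[u0]] := set_0Vmem (par1 v :&: par2 v).
  by rewrite i0 cards0 mul0r !addr_ge0.
rewrite inE => /andP[/parentsP[j1 [_ v1 _]] /parentsP[j2 [_ v2 _]]].
have small : #|par1 v :&: par2 v|%:R / (#|par1 v|%:R * #|par2 v|%:R) <= M%:R^-1 :> R ->
   #|par1 v :&: par2 v|%:R / (#|par1 v|%:R * #|par2 v|%:R) <=
   (v \in K1)%:R + (v \in K2)%:R + M%:R^-1 + Y v.
  by move/le_trans; apply; rewrite -addrA addrC -addrA; apply: ler_wpDr; rewrite ?addr_ge0.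
case: (boolP (v \in K1)) => vK1 in small *.
  apply: (@le_trans _ _ 1); last by rewrite -!addrA lerDl !addr_ge0.
  rewrite -[leRHS]invr1; apply: (@common_parent_ratio _ 1) => //.
  by rewrite (parents_layer v1); have [x xj xv] := layer_pred v1;
     apply/orP; left; apply/card_gt0P; exists x; rewrite inE xj.
case: (boolP (v \in K2)) => vK2 in small *.
  apply: (@le_trans _ _ 1); last by rewrite add0r -!addrA lerDl !addr_ge0.
  rewrite -[leRHS]invr1; apply: (@common_parent_ratio _ 1) => //.
  by rewrite (parents_layer v1); have [x xj xv] := layer_pred v1;
     apply/orP; left; apply/card_gt0P; exists x; rewrite inE xj.
have [lj1|j1l] := ltnP l j1.
  by apply: small; apply: common_parent_ratio => //; rewrite (parents_layer v1) K1P.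
have [lj2|j2l] := ltnP l j2.
  apply: small; apply: common_parent_ratio => //.
  by rewrite (parents_layer v2) K2P // orbT.
apply: le_trans (common_parent_ratio_le v) _; rewrite !add0r.
apply: ler_wpDl => //; rewrite natr_card; apply: ler_sum => u _.
case: (boolP (u \in _)) => /= [|_]; last by rewrite mulr_ge0.
rewrite inE (parents_layer v1) (parents_layer v2) !inE.
case/andP => /andP[u1 a1] /andP[u2 a2].
by rewrite (parent_ball u1 v1 j1l) (parent_ball u2 v2 j2l) a1 a2 mulr1.
Qed.

End Overlap.

(** * The overlap bound for a fixed number of vertices *)

Section FiniteBound.
Variables (R : realType) (V : finType) (r : V) (q rho eps : R).
Hypothesis q_ge0 : 0 <= q.
Hypothesis q_le1 : q <= 1.
Hypothesis rho_ge0 : 0 <= rho.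
Hypothesis rho_le1 : rho <= 1.
Hypothesis eps_gt0 : 0 < eps.

Definition pair_pmf (t : bool * bool * bool) : R :=
  bernoulli_pmf q t.1.1 * bernoulli_pmf (1 - rho) t.1.2 * bernoulli_pmf q t.2.

Definition status1 (t : bool * bool * bool) : bool := t.1.1.
Definition status2 (t : bool * bool * bool) : bool := if t.1.2 then t.2 else t.1.1.

Local Notation mu := pair_pmf.
Local Notation n := (#|V|%:R : R).
Local Notation D := (n * q).

Lemma sum_bool3 (F : bool * bool * bool -> R) :
  \sum_t F t = F (true, true, true) + F (true, true, false) +
               F (true, false, true) + F (true, false, false) +
               F (false, true, true) + F (false, true, false) +
               F (false, false, true) + F (false, false, false).
Proof.
rewrite (eq_bigr (fun t => F (t.1, t.2))); last by case.
rewrite -(pair_bigA _ (fun s c => F (s, c))) /=.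
rewrite (eq_bigr (fun s => (fun x y => \sum_c F ((x, y), c)) s.1 s.2)); last by case.
rewrite -(pair_bigA _ (fun x y => \sum_c F ((x, y), c))) /=.
by rewrite !big_bool /= !addrA.
Qed.

Lemma pair_pmf_ge0 t : 0 <= mu t.
Proof. have rho01 : 0 <= 1 - rho <= 1 by rewrite subr_ge0 rho_le1 gerBl.
by rewrite /mu !mulr_ge0 ?bernoulli_pmf_ge0 ?q_ge0. Qed.

Lemma pair_pmf_sum : \sum_t mu t = 1.
Proof. by rewrite sum_bool3 /mu /bernoulli_pmf /=; ring. Qed.

Lemma eprob_status1 : eprob mu status1 = q.
Proof. by rewrite /eprob /mean sum_bool3 /mu /bernoulli_pmf /=; ring. Qed.

Lemma eprob_status2 : eprob mu status2 = q.
Proof. by rewrite /eprob /mean sum_bool3 /mu /bernoulli_pmf /=; ring. Qed.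

Lemma eprob_both : eprob mu (fun t => status1 t && status2 t) = (rho + (1 - rho) * q) * q.
Proof. by rewrite /eprob /mean sum_bool3 /mu /bernoulli_pmf /=; ring. Qed.

Definition rgraph (g : bool * bool * bool -> bool) (w : sample V) : {set {set V}} :=
  [set val i | i in [set i : vpair V | g (w i)]].

Lemma rgraph_pair g w e : e \in rgraph g w -> #|e| = 2%N.
Proof. by case/imsetP => i _ ->; apply/eqP; exact: (valP i). Qed.

Variables (M l : nat) (a b c rho1 : R).
Hypothesis M_gt0 : (0 < M)%N.
Hypothesis a_gt0 : 0 < a.
Hypothesis b_ge0 : 0 <= b.
Hypothesis c_ge0 : 0 <= c.
Hypothesis b_le : b <= n / 4.
Hypothesis Mqa : M%:R <= q * (a / 2) / 2.
Hypothesis ll : (l * l <= #|V|)%N.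
Hypothesis rho1E : rho + (1 - rho) * q <= rho1.
Hypothesis rho1_le1 : rho1 <= 1.
Hypothesis rhoD : 2 <= rho1 * D.

Let D2 : 2 <= D.
Proof. by apply: (le_trans rhoD); rewrite ler_piMl // mulr_ge0. Qed.

(** The three terms account for a failure of expansion, for a layer [l] smaller than [D^l / 2], and
    for a ball of radius [l + 1] smaller than [a] around a ball of radius [l] of size at least
    [D^l / 2]. *)
Definition not_thick_bound : R :=
  expR (2 * n - b * (q * (a / 2) / 2 - M%:R)) +
  4 * ((D - 1)^-1 + 2 * (l * l)%:R / n + 32 * D ^+ l / n) +
  expR (c * a) * (expR (- c) + expR (- (q * (D ^+ l / 2)))) ^+ #|V|.

Lemma prob_not_thick g : eprob mu g = q ->
  Ex mu (fun w => (~~ thick r M l a b (rgraph g w))%:R) <= not_thick_bound.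
Proof.
move=> gq; have mu0 := pair_pmf_ge0; have mu1 := pair_pmf_sum.
have H1 := @prob_not_expands R V _ mu mu0 mu1 g M (a / 2) b.
have H2 := @prob_layer_small R V _ mu r mu0 mu1 g l.
have H3 := @prob_ball_step R V _ mu r mu0 mu1 g l (D ^+ l / 2) a c c_ge0.
rewrite gq in H1 H2 H3; apply: le_trans (lerD (lerD (H1 Mqa) (H2 D2 ll)) H3).
rewrite -!ExD; apply: Ex_le => // w; rewrite /thick negb_and.
set e := rgraph_adj g w; rewrite -/(rgraph_adj g w) -/e.
set A := expands _ _ _ _; case: (boolP A) => /= [_|_]; last first.
  by rewrite -addrA lerDl addr_ge0.
rewrite -ltNge add0r; case: ltP => [Ba|_] /=; last by rewrite addr_ge0.
have [_|lay] := ltP (#|layer r e set0 l|%:R) (D ^+ l / 2); first by rewrite lerDl.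
rewrite add0r (le_trans lay) //= ?Ba //.
by rewrite ler_nat subset_leq_card // layer_sub.
Qed.

(** If one of the graphs is not thick, the conditional probability is bounded by 1. If both are,
    Markov's inequality for the number of common directed edges applies, with the tree sizes bounded
    below by [n / 4]. *)
Lemma Pr_overlap_gt_le : (2 <= #|V|)%N ->
  Pr_overlap_gt r q rho eps <= 2 * not_thick_bound +
    4 / (eps * n) * (4 * b + n / M%:R + rho1 * D * joint_bound V q rho1 l).
Proof.
move=> V2; have mu0 := pair_pmf_ge0; have mu1 := pair_pmf_sum.
set k := 4 / (eps * n).
have n0 : 0 < n by rewrite ltr0n ltnW.
have k0 : 0 <= k by rewrite divr_ge0 // mulr_ge0 // ltW.
pose th g w := thick r M l a b (rgraph g w).
pose Y w : R := \sum_v \sum_u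
  (u \in ball r (rgraph_adj status1 w) [set v] l :&:
         ball r (rgraph_adj status2 w) [set v] l)%:R *
  (rgraph_adj status1 w u v && rgraph_adj status2 w u v)%:R.
have Y0 w : 0 <= Y w by apply: sumr_ge0 => v _; apply: sumr_ge0 => u _; rewrite mulr_ge0.
pose f1 w := unif_pmf R (comp_spts (graph1 w) r); pose f2 w := unif_pmf R (comp_spts (graph2 w) r).
have f10 w T : 0 <= f1 w T by rewrite /f1 /unif_pmf divr_ge0.
have f20 w T : 0 <= f2 w T by rewrite /f2 /unif_pmf divr_ge0.
pose P w := \sum_(T1 : {set {set V}}) \sum_(T2 : {set {set V}} | eps < overlap R r T1 T2)
  f1 w T1 * f2 w T2.
have -> : Pr_overlap_gt r q rho eps = Ex mu P.
  apply: eq_bigr => w _; rewrite /P mulr_sumr; apply: eq_bigr => T1 _.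
  by rewrite mulr_sumr; apply: eq_bigr => T2 _; rewrite /joint_pmf -mulrA.
apply: (@le_trans _ _ (Ex mu (fun w => (~~ th status1 w)%:R + (~~ th status2 w)%:R +
    k * (4 * b + n / M%:R + Y w)))); last first.
  rewrite !ExD ExZ !ExD !(Ex_cst mu1) (mulr_natl _ 2) mulr2n.
  apply: lerD; first by apply: lerD; apply: prob_not_thick;
    rewrite ?eprob_status1 ?eprob_status2.
  rewrite ler_wpM2l // lerD2l; apply: Ex_common_children => //.
  - exact: eprob_status1.
  - exact: eprob_status2.
  - by rewrite eprob_both ler_wpM2r.
apply: Ex_le => // w.
have rhs0 : 0 <= k * (4 * b + n / M%:R + Y w).
  by rewrite mulr_ge0 // !addr_ge0 ?mulr_ge0 ?invr_ge0.
have P1 : P w <= 1.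
  apply: (@le_trans _ _ (\sum_T1 f1 w T1 * \sum_T2 f2 w T2)).
    apply: ler_sum => T1 _; rewrite mulr_sumr big_mkcond /=; apply: ler_sum => T2 _.
    by case: ifP => // _; rewrite mulr_ge0.
  rewrite -mulr_suml mulr_ile1 ?sumr_ge0 ?sum_unif_pmf_le1 //.
case: (boolP (th status1 w)) => t1 /=; last first.
  by apply: (le_trans P1); rewrite -addrA lerDl addr_ge0.
case: (boolP (th status2 w)) => t2 /=; last first.
  by apply: (le_trans P1); rewrite add0r lerDl.
rewrite !add0r.
have E1p : forall e, e \in graph1 w -> #|e| = 2%N := @rgraph_pair status1 w.
have E2p : forall e, e \in graph2 w -> #|e| = 2%N := @rgraph_pair status2 w.
apply: (@le_trans _ _ (k * \sum_T1 \sum_T2 f1 w T1 * f2 w T2 *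
    #|directed_edges r T1 :&: directed_edges r T2|%:R)); last first.
  rewrite ler_wpM2l //; apply: le_trans (expected_common_edges R r E1p E2p) _.
  exact: (common_parents_bound M_gt0 a_gt0 t1 t2).
rewrite mulr_sumr; apply: ler_sum => T1 _; rewrite mulr_sumr big_mkcond /=.
apply: ler_sum => T2 _; rewrite [leRHS]mulrCA.
case: (boolP (T1 \in comp_spts (graph1 w) r)) => T1S; last first.
  by rewrite /f1 /unif_pmf (negPf T1S) !mul0r if_same.
case: (boolP (T2 \in comp_spts (graph2 w) r)) => T2S; last first.
  by rewrite /f2 /unif_pmf (negPf T2S) mul0r mulr0 mul0r if_same.
have s1 := thick_spt_size M_gt0 a_gt0 E1p t1 b_le V2 T1S.
have s2 := thick_spt_size M_gt0 a_gt0 E2p t2 b_le V2 T2S.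
have := overlap_markov r eps_gt0 s1 s2; rewrite -/k.
have ff0 : 0 <= f1 w T1 * f2 w T2 := mulr_ge0 (f10 w T1) (f20 w T2).
case: ifP => _ h; last exact: mulr_ge0 ff0 (mulr_ge0 k0 (ler0n _ _)).
by rewrite ler_peMr.
Qed.

End FiniteBound.

(** * Asymptotics *)

Section Asymptotics.
Variable R : realType.
Implicit Types (x d : R) (l : nat).

Lemma expRN_le_inv x : 0 < x -> expR (- x) <= x^-1.
Proof.
move=> x0; rewrite expRN lef_pV2 ?posrE ?expR_gt0 //.
by apply: le_trans (expR_ge1Dx x); rewrite lerDr.
Qed.

Lemma expRN_le_half x : 0 <= x -> x <= 1 -> expR (- x) <= 1 - x / 2.
Proof.
move=> x0 x1; rewrite expRN -[leLHS]mul1r ler_pdivrMr ?expR_gt0 //.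
apply: (@le_trans _ _ ((1 - x / 2) * (1 + x))); first nra.
by rewrite ler_wpM2l ?expR_ge1Dx //; lra.
Qed.

(** Writing [8 d^3] as a sixth power of [Num.sqrt (2 * d)] turns the crude bound [ln s <= s] into
    growth of order [sqrt d], which leaves room for a constant factor below [d]. *)
Lemma ln_cube_le d : 1 <= d -> ln (8 * d ^+ 3) <= 6 * Num.sqrt (2 * d).
Proof.
move=> d1; have d0 : 0 < d by rewrite (lt_le_trans _ d1).
have -> : 8 * d ^+ 3 = Num.sqrt (2 * d) ^+ 6.
  by rewrite (exprM _ 2 3) sqr_sqrtr ?mulr_ge0 ?(ltW d0) //; ring.
have s0 : 0 < Num.sqrt (2 * d) by rewrite sqrtr_gt0 mulr_gt0.
by rewrite lnXn // -[leLHS]mulr_natl ler_wpM2l // ltW // ln_sublinear.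
Qed.

Lemma sqr_le_exp4 l : (l * l <= 4 ^ l)%N.
Proof.
elim: l => // -[|l] IH //; rewrite expnS; apply: leq_trans (leq_mul (leqnn 4) IH); lia.
Qed.

Lemma level_exists (D y : R) : 4 <= D -> 1 <= y ->
  exists l, D ^+ l <= y /\ y < D ^+ l.+1.
Proof.
move=> D4 y1; have D1 : 1 <= D by rewrite (le_trans _ D4) // ler1n.
have exm : exists m, y < D ^+ m.
  exists (Num.trunc y).+1; apply: lt_le_trans (truncnS_gt y) _.
  apply: (@le_trans _ _ (4 ^+ (Num.trunc y).+1)); last by rewrite lerXn2r ?nnegrE // (le_trans _ D4).
  by rewrite -natrX ler_nat ltnW // ltn_expl.
case: (ex_minnP exm) => -[|m] ym min; first by move: ym; rewrite expr0 ltNge y1.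
exists m; split => //; rewrite leNgt; apply/negP => /min; by rewrite ltnn.
Qed.

(** * Estimates at the level [l], with [d] the fourth root of the mean degree *)

Variables (V : finType) (r : V) (d : R) (l : nat).
Local Notation n := (#|V|%:R : R).
Local Notation D := (d ^+ 4).
Hypothesis d_ge4 : 4 <= d.
Hypothesis n_ge : d ^+ 4 <= n.
Hypothesis l_low : D ^+ l <= n / d ^+ 3.
Hypothesis l_high : n / d ^+ 3 < D ^+ l.+1.

Let d0 : 0 < d. Proof. by apply: lt_le_trans d_ge4. Qed.
Let n0 : 0 < n. Proof. by apply: lt_le_trans n_ge; rewrite exprn_gt0. Qed.
Let nq : n * (D / n) = D.
Proof. by rewrite mulrCA divff ?mulr1 // gt_eqF. Qed.
Let dn : d <= n.
Proof. by apply: le_trans n_ge; rewrite ler_eXnr // (le_trans _ d_ge4) // ler1n. Qed.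
Let d3 : 0 < d ^+ 3. Proof. by rewrite exprn_gt0. Qed.
Let z_le : D ^+ l / n <= (d ^+ 3)^-1.
Proof. by rewrite ler_pdivrMr // mulrC. Qed.

Lemma sqr_level_le : (l * l)%:R <= D ^+ l.
Proof.
apply: (@le_trans _ _ (4 ^+ l)); first by rewrite -natrX ler_nat sqr_le_exp4.
rewrite lerXn2r ?nnegrE ?exprn_ge0 ?(ltW d0) //.
by apply: (le_trans d_ge4); rewrite ler_eXnr // (le_trans _ d_ge4) // ler1n.
Qed.

(** The three terms are at most [1 / d], [144 / d] and [16 / d]. The value of [A] turns the first
    exponent into [- 2 n]; in the second, each of [1 / (D - 1)], [l^2 / n] and [D^l / n] is of order
    [1 / d]. *)
Lemma not_thick_bound_small (M : nat) (del A : R) : 0 < del ->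
  A = 4 * M%:R + 16 / del -> (192 * A) ^+ 2 <= d ->
  not_thick_bound V (D / n) M l (A / (D / n)) (del * n) (ln (8 * d ^+ 3)) <= 161 / d.
Proof.
move=> del0 AE Ad; have d0' := d0; have n0' := n0; have zl := z_le.
have dn' := dn; have nq' := nq; have d30 := d3; have d4 := d_ge4.
have A0 : 0 < A by rewrite AE ltr_wpDl ?mulr_ge0 // divr_gt0.
have q0 : 0 < D / n by rewrite divr_gt0 // exprn_gt0.
rewrite /not_thick_bound nq'.
have -> : 161 / d = 1 / d + 144 / d + 16 / d by rewrite -!mulrDl; congr (_ / _); ring.
apply: lerD; [apply: lerD|].
- have -> : D / n * (A / (D / n) / 2) / 2 = A / 4.
    have := divff (lt0r_neq0 q0); set i := (D / n)^-1; set q := D / n => qi.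
    have -> : q * (A * i / 2) / 2 = (q * i) * A / 4 by field.
    by rewrite qi mul1r.
  have -> : del * n * (A / 4 - M%:R) = 4 * n.
    by rewrite AE; field; rewrite gt_eqF.
  have -> : 2 * n - 4 * n = - (2 * n) by ring.
  apply: le_trans (expRN_le_inv _) _; first by rewrite mulr_gt0.
  by rewrite mul1r lef_pV2 ?posrE ?mulr_gt0 //; lra.
- have i1 : (D - 1)^-1 <= 2 / d.
    have D2 : d / 2 <= D - 1.
      have : 1 <= d ^+ 3 by rewrite exprn_ege1 // (le_trans _ d4) // ler1n.
      by rewrite exprS; nra.
    have -> : 2 / d = (d / 2)^-1 by rewrite invfM invrK mulrC.
    by rewrite lef_pV2 ?posrE ?divr_gt0 // (lt_le_trans _ D2) ?divr_gt0.
  have i3 : (d ^+ 3)^-1 <= d^-1.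
    by rewrite lef_pV2 ?posrE // ler_eXnr // (le_trans _ d4) // ler1n.
  have s1 : (l * l)%:R / n <= d^-1.
    apply: le_trans i3; apply: le_trans zl; rewrite ler_wpM2r ?invr_ge0 ?(ltW n0') //.
    exact: sqr_level_le.
  have := le_trans zl i3; rewrite -!mulrA; move: i1 s1.
  by set x := (D - 1)^-1; set y := d^-1; set s := _ / n; set z := _ / n; lra.
(* By [l_high], [x0] is a lower bound for [q D^l / 2]. The choice of [c] makes [expR (- c)] equal to
   [x0 / 4], so the two exponentials sum to at most [1 - x0 / 4]. *)
- set c := ln _; set x0 := (2 * d ^+ 3)^-1.
  have d31 : 1 <= d ^+ 3 by rewrite exprn_ege1 // (le_trans _ d4) // ler1n.
  have x00 : 0 < x0 by rewrite invr_gt0 mulr_gt0.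
  have x01 : x0 <= 1 by rewrite invf_le1 ?mulr_gt0 //; lra.
  have e1 : expR (- c) = x0 / 4.
    by rewrite expRN lnK ?posrE ?mulr_gt0 // /x0; field; rewrite gt_eqF.
  have e2 : expR (- (D / n * (D ^+ l / 2))) <= 1 - x0 / 2.
    apply: le_trans (expRN_le_half (ltW x00) x01); rewrite ler_expR lerN2.
    have -> : D / n * (D ^+ l / 2) = D ^+ l.+1 / (2 * n) by rewrite (exprS D l); move: (D ^+ l) => X; field; rewrite gt_eqF.
    rewrite ler_pdivlMr ?mulr_gt0 //; apply: le_trans (ltW l_high).
    by rewrite le_eqVlt /x0; apply/orP; left; apply/eqP; field; rewrite gt_eqF.
  have e3 : expR (- c) + expR (- (D / n * (D ^+ l / 2))) <= expR (- (x0 / 4)).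
    rewrite e1; apply: le_trans (expR_N_ge _); move: e2; set e := expR _; lra.
  apply: (@le_trans _ _ (expR (c * (A / (D / n))) * expR (- (x0 / 4)) ^+ #|V|)).
    by rewrite ler_wpM2l ?expR_ge0 // lerXn2r ?nnegrE ?addr_ge0 ?expR_ge0.
  rewrite -expRM_natl -expRD.
  (* With [s^2 = 2 d] and [192 A <= s], the product is at most [6 s^2 / 192 = d / 16]. *)
  have cA : c * A <= d / 16.
    pose s := Num.sqrt (2 * d); have cs : c <= 6 * s by apply: ln_cube_le; lra.
    have s0 : 0 < s by rewrite sqrtr_gt0 mulr_gt0.
    have ss : s ^+ 2 = 2 * d by rewrite sqr_sqrtr // mulr_ge0 // ltW.
    have As : 192 * A <= s.
      rewrite -(ger0_norm (_ : 0 <= 192 * A)) ?mulr_ge0 ?(ltW A0) // -sqrtr_sqr.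
      by rewrite ler_wsqrtr //; move: d0' Ad; lra.
    apply: (@le_trans _ _ (6 * s * A)); first by rewrite ler_wpM2r // ltW.
    by move: ss As s0; nra.
  apply: (@le_trans _ _ (expR (- (d / 16)))); last first.
    by apply: le_trans (expRN_le_inv _) _; rewrite ?divr_gt0 // invfM invrK mulrC.
  rewrite ler_expR.
  have -> : c * (A / (D / n)) + n * - (x0 / 4) = n / d ^+ 3 * (c * A / d - 1 / 8).
    by rewrite /x0 [D]exprS; field; rewrite !gt_eqF // exprn_gt0.
  have h1 : c * A / d <= 1 / 16 by rewrite ler_pdivrMr //; move: cA; lra.
  have h2 : d <= n / d ^+ 3 by rewrite ler_pdivlMr // -exprS.
  by move: h1 h2 d0'; set u := c * A / d; set y := n / d ^+ 3; nra.
Qed.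

(** With [z = D^l / n <= 1 / d^3], the two terms are of order [rho1^l D z] and [D z^2]. Here
    [D z <= d], and [rho1^l = exp (- kap l)] with [l >= d - 2 >= d / 2] is of order [1 / d^2] by
    [exp (- y) <= 2 / y^2]. *)
Lemma joint_term_small (rho1 kap : R) : 0 < kap -> rho1 = expR (- kap) ->
  d - 2 <= l%:R ->
  rho1 * D * joint_bound V (D / n) rho1 l / n <= (16 / kap ^+ 2 + 16) / d.
Proof.
move=> kap0 rE dl; have d0' := d0; have n0' := n0; have zl := z_le; have d4 := d_ge4.
have r0 : 0 < rho1 by rewrite rE expR_gt0.
have r1 : rho1 <= 1 by rewrite rE -expR0 ler_expR oppr_le0 ltW.
rewrite /joint_bound nq exprMn mul2n -addnn exprD.
set X := D ^+ l in zl *; set P := rho1 ^+ l.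
have X0 : 0 < X by rewrite !exprn_gt0.
have Pd : P * d <= 8 / kap ^+ 2 / d.
  have -> : P = expR (- (kap * l%:R)) by rewrite /P rE -expRM_natl mulrN mulrC.
  apply: (@le_trans _ _ (expR (- (kap * (d / 2))) * d)).
    rewrite ler_wpM2r ?(ltW d0') // ler_expR lerN2 ler_wpM2l ?(ltW kap0) //; lra.
  have y0 : 0 < kap * (d / 2) by rewrite mulr_gt0 ?divr_gt0.
  have := expR_ge1Dxn 1 (ltW y0); rewrite (_ : 2`! = 2)%N // => ey.
  have : expR (- (kap * (d / 2))) <= (kap * (d / 2)) ^- 2 * 2.
    rewrite expRN -[X in _ <= _ * X]invrK -invfM lef_pV2 ?posrE ?expR_gt0 ?mulr_gt0 ?invr_gt0 ?exprn_gt0 //.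
    by apply: le_trans ey; rewrite lerDr.
  move=> h; apply: (@le_trans _ _ ((kap * (d / 2)) ^- 2 * 2 * d)).
    by rewrite ler_wpM2r // ltW.
  by rewrite le_eqVlt; apply/orP; left; apply/eqP; field; rewrite !gt_eqF.
have step : rho1 * D * (2 * (P * X) - 1 + 16 * (X * X) / n) / n <=
    2 * P * D * (X / n) + 16 * D * (X / n) * (X / n).
  apply: (@le_trans _ _ (1 * D * (2 * (P * X) + 16 * (X * X) / n) / n)).
    have P0 : 0 <= P by rewrite exprn_ge0 // ltW.
    have D0 : 0 <= D by rewrite exprn_ge0 // ltW.
    rewrite ler_wpM2r ?invr_ge0 ?(ltW n0') //.
    apply: (@le_trans _ _ (rho1 * D * (2 * (P * X) + 16 * (X * X) / n))).
      by rewrite ler_wpM2l ?mulr_ge0 ?(ltW r0) //; lra.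
    rewrite ler_wpM2r ?ler_wpM2r // addr_ge0 ?mulr_ge0 ?invr_ge0 ?(ltW X0) ?(ltW n0') //.
  by rewrite le_eqVlt; apply/orP; left; apply/eqP; field; rewrite gt_eqF.
apply: (le_trans step); move: zl; set z := X / n => zl.
have z0 : 0 <= z by rewrite divr_ge0 // ltW.
have Dz : D * z <= d.
  apply: (@le_trans _ _ (D * (d ^+ 3)^-1)); first by rewrite ler_wpM2l ?exprn_ge0 ?(ltW d0').
  by rewrite exprSr mulrAC divff ?mul1r // gt_eqF // exprn_gt0.
have dz : d * z <= d^-1.
  apply: (@le_trans _ _ (d * (d ^+ 3)^-1)); first by rewrite ler_wpM2l ?(ltW d0').
  have -> : d * (d ^+ 3)^-1 = d^-1 * d^-1 by field; rewrite gt_eqF.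
  by rewrite ler_piMl ?invr_ge0 ?(ltW d0') // invf_le1 // (le_trans _ d4) // ler1n.
have P0 : 0 <= P by rewrite exprn_ge0 // ltW.
have t1 : P * (D * z) <= P * d by rewrite ler_wpM2l.
have t2 : (D * z) * z <= d * z by rewrite ler_wpM2r.
have -> : (16 / kap ^+ 2 + 16) / d = 2 * (8 / kap ^+ 2 / d) + 16 * d^-1 by field; rewrite !gt_eqF.
by move: Pd dz t1 t2; set u := 8 / _ / d; set v := d^-1; lra.
Qed.

End Asymptotics.

(** * Choice of the parameters *)

Lemma Pr_overlap_gt_ge0 (R : realType) (V : finType) (r : V) (q rho eps : R) :
  0 <= q <= 1 -> 0 <= rho <= 1 -> 0 <= Pr_overlap_gt r q rho eps.
Proof.
move=> /andP[q0 q1] /andP[r0 r1]; apply: sumr_ge0 => w _; apply: sumr_ge0 => T1 _.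
apply: sumr_ge0 => T2 _; rewrite /joint_pmf !mulr_ge0 ?divr_ge0 //.
by apply: prodr_ge0 => e _; exact: (pair_pmf_ge0 q0 q1 r0 r1 (w e)).
Qed.

(** The error bound depends on [d] alone; [n] enters through [d^4 <= C ln n], which makes both [n]
    and the level [l] large in terms of [d]. *)
Lemma Pr_overlap_small (R : realType) (rho eps tau C : R) :
  0 < rho -> rho < 1 -> 0 < eps -> 0 < tau -> 0 < C ->
  exists d0 : R, forall (V : finType) (r : V) (d : R), d0 <= d ->
    d ^+ 4 <= C * ln (#|V|%:R : R) ->
    0 <= Pr_overlap_gt r (d ^+ 4 / #|V|%:R) rho eps <= tau.
Proof.
move=> rho0 rho1 eps0 tau0 C0.
(* The midpoint of [rho] and 1 dominates [rho + (1 - rho) * q] as soon as [q <= 1 / 2], and stays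
   below 1. *)
have [rh rh_def] : exists rh : R, rh = (1 + rho) / 2 by eexists.
have rh0 : 0 < rh by lra.
have [kap kap0 rhE] : exists2 kap : R, 0 < kap & rh = expR (- kap).
  exists (- ln rh); first by rewrite oppr_gt0 ln_lt0 //; lra.
  by rewrite opprK lnK // posrE.
(* [M] makes [4 / (eps M)] at most [tau / 6], and [del] below does the same for [16 del / eps];
   [del <= 1 / 4] serves the condition [b <= n / 4]. *)
have [M M_gt0 M24] : exists2 M : nat, (0 < M)%N & 24 / (eps * tau) <= M%:R.
  by exists (Num.trunc (24 / (eps * tau))).+1 => //; apply: ltW; exact: truncnS_gt.
have [del [del0 del4 delt]] : exists del : R,
    [/\ 0 < del, del <= 1 / 4 & del <= eps * tau / 96].
  exists (Num.min (1 / 4) (eps * tau / 96)); split.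
  - by rewrite lt_min !divr_gt0 ?mulr_gt0.
  - by rewrite ge_min lexx.
  - by rewrite ge_min lexx orbT.
have [A AE] : exists A : R, A = 4 * M%:R + 16 / del by eexists.
(* [K / d] collects all errors of order [1 / d]: twice [161 / d] from the two thickness events, and
   the joint term. *)
have [K K_def] : exists K : R, K = 322 + 4 / eps * (16 / kap ^+ 2 + 16) by eexists.
have K0 : 0 < K.
  by rewrite K_def ltr_wpDr // mulr_ge0 ?divr_ge0 ?addr_ge0 ?divr_ge0 ?exprn_ge0 ?(ltW kap0) ?(ltW eps0).
exists (4 + (192 * A) ^+ 2 + 4 * C + 4 * C ^+ 2 + 2 * K / tau) => V r d dbig dln.
have Kt : 0 < 2 * K / tau by rewrite divr_gt0 ?mulr_gt0.
have A2 := sqr_ge0 (192 * A); have C2 := sqr_ge0 C.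
have d4 : 4 <= d by move: dbig Kt A2 C2 C0; lra.
have dA : (192 * A) ^+ 2 <= d by move: dbig Kt A2 C2 C0; lra.
have dC : 4 * C <= d by move: dbig Kt A2 C2 C0; lra.
have dC2 : 4 * C ^+ 2 <= d by move: dbig Kt A2 C2 C0; lra.
have dK : 2 * K / tau <= d by move: dbig Kt A2 C2 C0; lra.
have d1 : 1 <= d by apply: le_trans d4; rewrite ler1n.
have d0 : 0 < d by exact: lt_le_trans d1.
set n : R := #|V|%:R in dln *.
have n0 : 0 < n by rewrite ltr0n; apply/card_gt0P; exists r.
have dd4 : d <= d ^+ 4 by rewrite ler_eXnr.
have D0 : 0 < d ^+ 4 by rewrite exprn_gt0.
(* From [exp y >= y^2 / 2] at [y = d^4 / C], using [4 C^2 <= d^4]. *)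
have nbig : 2 * d ^+ 4 <= n.
  have y0 : 0 <= d ^+ 4 / C by rewrite divr_ge0 // ltW.
  have -> : n = expR (ln n) by rewrite lnK // posrE.
  apply: (@le_trans _ _ (expR (d ^+ 4 / C))); last first.
    by rewrite ler_expR ler_pdivrMr // mulrC.
  have := expR_ge1Dxn 1 y0; rewrite (_ : 2`! = 2)%N //; apply: le_trans.
  rewrite expr_div_n ler_wpDl // ler_pdivlMr // ler_pdivlMr ?exprn_gt0 //.
  have : 4 * C ^+ 2 <= d ^+ 4 by exact: le_trans dd4.
  by set y := d ^+ 4 in D0 *; nra.
have nD : d ^+ 4 <= n by move: nbig D0; lra.
have d3n : 1 <= n / d ^+ 3.
  rewrite ler_pdivlMr ?exprn_gt0 // mul1r; apply: le_trans nD.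
  by rewrite ler_weXn2l.
have [l [ll lh]] := level_exists (le_trans d4 dd4) d3n.
(* Since [n < D^(l+1) d^3 <= D^(l+2)], one has [ln n <= 4 d (l + 2)]. Together with [d^4 <= C ln n]
   and [4 C <= d] this forces [d <= l + 2]. *)
have dl : d - 2 <= l%:R.
  have h : ln n <= (l + 2)%:R * (4 * d).
    apply: (@le_trans _ _ (ln ((d ^+ 4) ^+ (l + 2)))).
      rewrite ler_ln ?posrE ?exprn_gt0 // addn2 (exprSr (d ^+ 4) l.+1); apply: ltW.
      apply: (@lt_le_trans _ _ (d ^+ 4 ^+ l.+1 * d ^+ 3)).
        by move: lh; rewrite ltr_pdivrMr // exprn_gt0.
      apply: ler_wpM2l; first by rewrite !exprn_ge0 // ltW.
      by rewrite ler_weXn2l.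
    rewrite !lnXn ?exprn_gt0 // -[leLHS]mulr_natl ler_wpM2l // -[leLHS]mulr_natl ler_wpM2l //.
    by rewrite ltW // ln_sublinear.
  have h2 : d ^+ 4 <= C * ((l + 2)%:R * (4 * d)) by apply: le_trans dln _; rewrite ler_wpM2l // ltW.
  have h3 : 4 * C * d * d <= d ^+ 4 / d * d.
    rewrite ler_wpM2r ?(ltW d0) //; have -> : d ^+ 4 / d = d * d * d by field; rewrite gt_eqF.
    by rewrite ler_wpM2r ?(ltW d0) // ler_pM ?mulr_ge0 ?(ltW C0) //; nra.
  have h4 : d ^+ 4 / d * d = d ^+ 4 by rewrite mulfVK // gt_eqF.
  have : (4 * C * d) * d <= (4 * C * d) * (l + 2)%:R by move: h2 h3; rewrite h4; lra.
  by rewrite ler_pM2l ?mulr_gt0 // natrD; lra.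
have qhalf : d ^+ 4 / n <= 1 / 2 by rewrite ler_pdivrMr //; move: nbig; lra.
have q0 : 0 < d ^+ 4 / n by rewrite divr_gt0.
have nq : n * (d ^+ 4 / n) = d ^+ 4 by rewrite mulrCA divff ?mulr1 // gt_eqF.
apply/andP; split; first by apply: Pr_overlap_gt_ge0; apply/andP; split; lra.
have A0 : 0 < A by rewrite AE ltr_wpDl ?mulr_ge0 // divr_gt0.
have V2 : (2 <= #|V|)%N by rewrite -(ler_nat R) -/n; move: nbig dd4 d4; lra.
have lln : (l * l <= #|V|)%N.
  rewrite -(ler_nat R); apply: (le_trans (sqr_level_le l d4)); apply: (le_trans ll).
  by rewrite ler_piMr ?(ltW n0) // invf_le1 ?exprn_gt0 // exprn_ege1.
have MA : M%:R <= d ^+ 4 / n * (A / (d ^+ 4 / n) / 2) / 2.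
  have -> : d ^+ 4 / n * (A / (d ^+ 4 / n) / 2) / 2 = A / 4 by field; rewrite !gt_eqF.
  have : 0 < 16 / del by rewrite divr_gt0.
  rewrite AE; lra.
have c0 : 0 <= ln (8 * d ^+ 3).
  have d31 : 1 <= d ^+ 3 by rewrite exprn_ege1.
  by rewrite ln_ge0 //; lra.
apply: le_trans (@Pr_overlap_gt_le R V r (d ^+ 4 / n) rho eps (ltW q0) _ (ltW rho0) (ltW rho1)
   eps0 M l (A / (d ^+ 4 / n)) (del * n) (ln (8 * d ^+ 3)) rh _ _ _ c0 _ MA lln _ _ _ V2) _ => //.
- by move: qhalf; lra.
- by rewrite divr_gt0.
- by rewrite mulr_ge0 // ltW.
- by rewrite mulrC ler_wpM2l ?(ltW n0) //; lra.
- by rewrite rh_def; move: qhalf q0 rho0 rho1; set q := _ / n; nra.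
- by lra.
- by rewrite -/n nq rh_def; move: dd4 d4 rho0; nra.
have B1 := not_thick_bound_small d4 nD ll lh del0 AE dA.
have B2 := joint_term_small d4 nD ll kap0 rhE dl.
rewrite -/n in B1 B2 *; rewrite nq.
set nt := not_thick_bound _ _ _ _ _ _ _ in B1 *.
set J := rh * d ^+ 4 * _ in B2 *.
have -> : 4 / (eps * n) * (4 * (del * n) + n / M%:R + J) =
    4 / eps * (4 * del) + 4 / eps * M%:R^-1 + 4 / eps * (J / n).
  by field; rewrite ?(gt_eqF n0) ?(gt_eqF eps0) ?pnatr_eq0 -?lt0n.
have s1 : 4 / eps * (4 * del) <= tau / 6.
  by rewrite mulrAC ler_pdivrMr //; move: delt; lra.
have s2 : 4 / eps * M%:R^-1 <= tau / 6.
  rewrite ler_pdivrMr ?ltr0n //; move: M24; rewrite ler_pdivrMr ?mulr_gt0 // => M24.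
  by rewrite ler_pdivrMr //; move: M24; lra.
have s3 : 4 / eps * (J / n) <= 4 / eps * ((16 / kap ^+ 2 + 16) / d).
  by rewrite ler_wpM2l // divr_ge0 // ltW.
have s4 : K / d <= tau / 2.
  by rewrite ler_pdivrMr //; move: dK; rewrite ler_pdivrMr //; lra.
have KE : K / d = 2 * (161 / d) + 4 / eps * ((16 / kap ^+ 2 + 16) / d).
  by rewrite K_def; field; rewrite ?(gt_eqF kap0) ?(gt_eqF eps0) ?(gt_eqF d0).
by move: B1 s1 s2 s3 s4; rewrite KE; lra.
Qed.

(** * Passage to the limit *)

(** The bound [s] is the supremum over a tail, kept in the extended reals because it may be
    infinite. *)
Lemma limn_esup_lt_eventually (R : realType) (u : nat -> \bar R) (y : \bar R) :
  (limn_esup u < y)%E ->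
  exists2 s : \bar R, (s < y)%E & exists N, forall n, (N <= n)%N -> (u n <= s)%E.
Proof.
rewrite /limn_esup limf_esupE => /ereal_inf_lt[_ [W [N _ NW] <-] sy].
exists (ereal_sup [set u x | x in W])%classic => //; exists N => n Nn.
by apply: ereal_sup_ubound; exists n => //; exact: NW.
Qed.

Local Open Scope classical_set_scope.

Theorem theorem1p6 (R : realType) (alpha : nat -> R) (rho : R)
  (alpha_gt0 : forall n : nat, (0 < n)%N -> 0 < alpha n)
  (liminf_alpha : (0 < limn_einf (fun n => (alpha n)%:E))%E)
  (limsup_alpha : (limn_esup (fun n => (alpha n)%:E) < +oo)%E)
  (rho_gt0 : 0 < rho) (rho_lt1 : rho < 1)
  (eps : R) (eps_gt0 : 0 < eps) :
  Pr_overlap_gt (ord0 : 'I_n.+1) (edge_prob alpha n.+1) rho eps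
    @[n --> \oo] --> (0 : R).
Proof.
have [C C0 [N1 alphaC]] : exists2 C : R, 0 < C & exists N, forall n, (N <= n)%N -> alpha n <= C.
  have [[s|//|] _ [N sP]] := limn_esup_lt_eventually limsup_alpha.
    exists (Num.max s 1); first by rewrite lt_max ltr01 orbT.
    by exists N => n Nn; rewrite le_max -lee_fin sP.
  by have := sP N (leqnn N).
have [c c0 [N2 alphac]] : exists2 c : R, 0 < c & exists N, forall n, (N <= n)%N -> c <= alpha n.
  have : (limn_esup (\- (fun n => (alpha n)%:E)) < 0)%E.
    by move: liminf_alpha; rewrite /limn_einf oppe_gt0.
  case/limn_esup_lt_eventually => -[s|//|] s0 [N sP].
    exists (- s); first by rewrite oppr_gt0 -lte_fin.
    by exists N => n /sP; rewrite /= lee_fin lerNl.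
  by have := sP N (leqnn N).
apply/cvgrPdist_le => tau tau0.
have [d0 d0P] := Pr_overlap_small rho_gt0 rho_lt1 eps_gt0 tau0 C0.
(* Beyond [N3] the logarithm exceeds [d0^4 / c], so the fourth root [d] of [alpha n * ln n] is at
   least [d0]. The maximum with 0 covers a negative [d0], for which fourth powers would not
   compare. *)
pose N3 := (Num.trunc (expR ((Num.max d0 0) ^+ 4 / c))).+1.
exists (maxn (maxn N1 N2) N3) => // n /=; rewrite !geq_max => /andP[/andP[n1 n2] n3].
have n1' := leqW n1; have n2' := leqW n2.
have lnn : (Num.max d0 0) ^+ 4 / c <= ln n.+1%:R.
  rewrite -[leLHS]expRK ler_ln ?posrE ?expR_gt0 //.
  apply: ltW; apply: lt_le_trans (truncnS_gt _) _; rewrite ler_nat; exact: leqW.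
have lnn0 : 0 <= ln n.+1%:R :> R by rewrite ln_ge0 // ler1n.
set x := alpha n.+1 * ln n.+1%:R.
have x0 : 0 <= x by rewrite mulr_ge0 // ltW // alpha_gt0.
pose d := Num.sqrt (Num.sqrt x).
have d4 : d ^+ 4 = x by rewrite (exprM _ 2 2) !sqr_sqrtr ?sqrtr_ge0.
have dd : d0 <= d.
  apply: (@le_trans _ _ (Num.max d0 0)); first by rewrite le_max lexx.
  have m0 : 0 <= Num.max d0 0 by rewrite le_max lexx orbT.
  rewrite -(@ler_pXn2r _ 4) ?nnegrE ?sqrtr_ge0 // d4.
  apply: (@le_trans _ _ (c * ln n.+1%:R)); last by rewrite ler_wpM2r ?alphac.
  by move: lnn; rewrite ler_pdivrMr // mulrC.
have := d0P 'I_n.+1 ord0 d dd; rewrite card_ord d4 => /(_ _)/andP[].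
  by rewrite ler_wpM2r ?alphaC.
by move=> P0 Pt; rewrite sub0r normrN ger0_norm.
Qed.
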